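(* Identify the monad $\mathbf V_1$ of probability valuations with the isomorphic monad $\mathbb P_{\mathtt P}^1$ of normalized linear previsions. The maps $r_{\mathtt{ADP}}\colon\mathcal P\ell_{\mathsf V}\mathbf V_1X\to\mathbb P_{\mathtt{ADP}}^1X$ and $s_{\mathtt{ADP}}^1\colon\mathbb P_{\mathtt{ADP}}^1X\to\mathcal P\ell_{\mathsf V}\mathbf V_1X$ form a distributing retraction of $\mathcal P\ell_{\mathsf V}\mathbf V_1$ onto $\mathbb P_{\mathtt{ADP}}^1$ on the category $\mathbf{KHaus}$ of compact Hausdorff spaces and continuous maps.
   Context: $\mathcal L X$ is the set of lower semicontinuous maps $h\colon X\to[0,\infty]$ with the pointwise ordering. The monads below are considered on compact Hausdorff spaces. Monad $\mathcal P\ell_{\mathsf V}$ (the non-empty Vietoris monad on $\mathbf{KHaus}$): in general a lens on $X$ is a non-empty set $Q\cap C$ with $Q$ compact saturated and $C$ closed; on a compact Hausdorff space the lenses are exactly the non-empty compact subsets. $\mathcal P\ell_{\mathsf V}X$ has the Vietoris topology, with subbasic open sets $\Box U=\{L\mid L\subseteq U\}$ and $\Diamond U=\{L\mid L\cap U\ne\emptyset\}$, $U$ open. On $\mathbf{KHaus}$, $\mathcal P\ell_{\mathsf V}f(L)=f[L]$, unit $x\mapsto\{x\}$, multiplication $\mathcal L\mapsto\bigcup\mathcal L$. Monad $\mathbf V_1$ (isomorphic on $\mathbf{KHaus}$ to the Radon probability measure monad): a probability valuation on $X$ is a map $\nu$ from the open sets of $X$ to $[0,\infty]$ with $\nu(\emptyset)=0$,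 $\nu(X)=1$, $\nu(U)+\nu(V)=\nu(U\cup V)+\nu(U\cap V)$, monotonic and preserving directed unions. $\mathbf V_1X$ has subbasic open sets $\{\nu\mid\nu(U)>r\}$. Put $\int h\,d\nu:=\int_0^\infty\nu(h^{-1}(]t,\infty]))\,dt$. $\mathbf V_1f(\nu)(V)=\nu(f^{-1}(V))$, unit $x\mapsto\delta_x$ (Dirac), multiplication $\xi\mapsto(U\mapsto\int_\nu\nu(U)\,d\xi)$. Previsions: a prevision on $X$ is a Scott-continuous map $F\colon\mathcal LX\to[0,\infty]$ with $F(ah)=aF(h)$ for $a\in\mathbb R_+$; it is linear (resp. superlinear, sublinear) if $F(h+h')=F(h)+F(h')$ (resp. $\ge$, $\le$), normalized if $F(\mathbf 1+h)=1+F(h)$. $\mathbb P_{\mathtt P}^1X$ is the space of normalized linear previsions with subbasic open sets $\{F\mid F(h)>r\}$; monad with action $F\mapsto(h\mapsto F(h\circ f))$, unit $x\mapsto(h\mapsto h(x))$, multiplication $\mathcal F\mapsto(h\mapsto\mathcal F(F\mapsto F(h)))$; $\nu\mapsto(h\mapsto\int h\,d\nu)$ is an isomorphism of monads $\mathbf V_1\cong\mathbb P_{\mathtt P}^1$. Normalized forks: pairs $(F^-,F^+)$ of a normalized superlinear prevision $F^-$ and a normalized sublinear prevision $F^+$ with $F^-(h+h')\le F^-(h)+F^+(h')\le F^+(h+h')$ for all $h,h'\in\mathcal LX$. $\mathbb P_{\mathtt{ADP}}^1X$ is their space, with subbasic open sets $\{F^-(h)>r\}$ and $\{F^+(h)>r\}$.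 Monad: unit $x\mapsto(h\mapsto h(x),h\mapsto h(x))$; action $(F^-,F^+)\mapsto(h\mapsto F^-(h\circ f),h\mapsto F^+(h\circ f))$; multiplication $(\mathcal F^-,\mathcal F^+)\mapsto(h\mapsto\mathcal F^-((F^-,F^+)\mapsto F^-(h)),\ h\mapsto\mathcal F^+((F^-,F^+)\mapsto F^+(h)))$. $r_{\mathtt{ADP}}(L):=(h\mapsto\min_{G\in L}G(h),\ h\mapsto\sup_{G\in L}G(h))$; $s_{\mathtt{ADP}}^1(F^-,F^+):=\{G\in\mathbb P_{\mathtt P}^1X\mid F^-(h)\le G(h)\le F^+(h)\ \forall h\in\mathcal LX\}$. A distributing retraction of $ST$ onto $U$ (for monads $S,T,U$ on a category) is a pair of natural transformations $r\colon ST\to U$, $s\colon U\to ST$ with $r\circ s=\mathrm{id}$ such that, with $i:=r\circ S\eta^T$, $j:=r\circ\eta^ST$, $e:=s\circ r$ and $f^{\underline S}:=\mu^S\circ Sf$ (juxtaposition being horizontal composition): $r\circ\eta^S\eta^T=\eta^U$; $r\circ\mu^ST=\mu^U\circ ir$; $r\circ S\mu^T=\mu^U\circ rj$; $e\circ\eta^ST=\eta^ST$; $e\circ S\mu^T=S\mu^T\circ eT$; $e\circ(s\circ\mu^U\circ jU)^{\underline S}=(s\circ\mu^U\circ jU)^{\underline S}\circ eU$. *)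

(* Defs.v *)
From HB Require Import structures.
From mathcomp Require Import all_boot all_order all_algebra.
From mathcomp Require Import all_classical all_reals.
From mathcomp Require Import topology normedtype ereal.
From mathcomp Require Import lra.

Set Implicit Arguments.
Unset Strict Implicit.
Unset Printing Implicit Defensive.

Import Order.TTheory GRing.Theory Num.Theory.
Import numFieldNormedType.Exports.

Local Open Scope classical_set_scope.
Local Open Scope ring_scope.

Reserved Notation "g \oc f" (at level 50, left associativity).

Record category := Category {
  obj :> Type;
  hom : obj -> obj -> Type;
  idc : forall a, hom a a;
  compc : forall a b c, hom b c -> hom a b -> hom a c;
  compc1 : forall a b (f : hom a b), compc f (idc a) = f;
  comp1c : forall a b (f : hom a b), compc (idc b) f = f;
  compcA : forall a b c d (h : hom c d) (g : hom b c) (f : hom a b),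
    compc h (compc g f) = compc (compc h g) f }.
Arguments idc {c} a : rename.
Notation "g \oc f" := (compc g f).

Record functor (C D : category) := Functor {
  fobj :> C -> D;
  fmap : forall a b, hom a b -> hom (fobj a) (fobj b);
  fmap1 : forall a, fmap (idc a) = idc (fobj a);
  fmapM : forall a b c (g : hom b c) (f : hom a b),
    fmap (g \oc f) = fmap g \oc fmap f }.
Arguments fmap {C D} f {a b} _ : rename.

Definition functor_id (C : category) : functor C C :=
  @Functor C C id (fun _ _ f => f) (fun _ => erefl) (fun _ _ _ _ _ => erefl).

Section functor_comp.
Variables (C D E : category) (G : functor D E) (F : functor C D).

Fact functor_comp1 a : fmap G (fmap F (idc a)) = idc (G (F a)).
Proof. by rewrite !fmap1. Qed.

Fact functor_compM a b c (g : hom b c) (f : hom a b) :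
  fmap G (fmap F (g \oc f)) = fmap G (fmap F g) \oc fmap G (fmap F f).
Proof. by rewrite !fmapM. Qed.

Definition functor_comp : functor C E :=
  @Functor C E (fun a => G (F a)) (fun _ _ f => fmap G (fmap F f))
    functor_comp1 functor_compM.
End functor_comp.

Record nat_trans (C D : category) (F G : functor C D) := NatTrans {
  component :> forall a, hom (F a) (G a);
  naturality : forall a b (f : hom a b),
    component b \oc fmap F f = fmap G f \oc component a }.

Record monad (C : category) := Monad {
  monad_functor :> functor C C;
  eta : nat_trans (functor_id C) monad_functor;
  mu : nat_trans (functor_comp monad_functor monad_functor) monad_functor;
  mu_fmap_eta : forall a : C, mu a \oc fmap monad_functor (eta a) = idc _;
  mu_eta : forall a : C, mu a \oc eta (monad_functor a) = idc _;
  muA : forall a : C,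
    mu a \oc fmap monad_functor (mu a) = mu a \oc mu (monad_functor a) }.
Arguments eta {C} m : rename.
Arguments mu {C} m : rename.

Section distributing_retraction.
Variables (C : category) (S T U : monad C).
Variables (r : nat_trans (functor_comp S T) U).
Variables (s : nat_trans U (functor_comp S T)).

(* The equalities of natural transformations are stated componentwise. The
   X-component of a horizontal composite of a : F -> F' and b : G -> G' is
   a (G' X) \oc fmap F (b X). *)
Definition kleisli_ext (X Y : C) (f : hom X (S Y)) : hom (S X) (S Y) :=
  mu S Y \oc fmap S f.
Definition dr_i (X : C) : hom (S X) (U X) := r X \oc fmap S (eta T X).
Definition dr_j (X : C) : hom (T X) (U X) := r X \oc eta S (T X).
Definition dr_e (X : C) : hom (S (T X)) (S (T X)) := s X \oc r X.

Record distributing_retraction : Prop := DistributingRetraction {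
  dr_retract : forall X, r X \oc s X = idc (U X);
  dr_eta : forall X, r X \oc (eta S (T X) \oc eta T X) = eta U X;
  dr_muS : forall X,
    r X \oc mu S (T X) = mu U X \oc (dr_i (U X) \oc fmap S (r X));
  dr_muT : forall X,
    r X \oc fmap S (mu T X) = mu U X \oc (r (U X) \oc fmap S (fmap T (dr_j X)));
  dr_e_eta : forall X, dr_e X \oc eta S (T X) = eta S (T X);
  dr_e_muT : forall X,
    dr_e X \oc fmap S (mu T X) = fmap S (mu T X) \oc dr_e (T X);
  dr_e_ext : forall X,
    dr_e X \oc kleisli_ext (s X \oc (mu U X \oc dr_j (U X)))
    = kleisli_ext (s X \oc (mu U X \oc dr_j (U X))) \oc dr_e (U X) }.
End distributing_retraction.

Record khaus := KHausSpace {
  khaus_space :> topologicalType;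
  khaus_compact : compact [set: khaus_space];
  khaus_hausdorff : hausdorff_space khaus_space }.

Section continuous_maps.
Variables X Y Z : topologicalType.

Definition cmap (f : X -> Y) (cf : continuous f) : continuousType X Y :=
  mkcts cf.

Definition cid : continuousType X X := idfun.

Definition ccomp (g : continuousType Y Z) (f : continuousType X Y) :
  continuousType X Z := g \o f.
End continuous_maps.

Definition KHaus : category.
Proof.
refine (@Category khaus (fun X Y => continuousType X Y) (fun X => cid X)
  (fun X Y Z g f => ccomp g f) _ _ _).
- by move=> X Y f; apply/continuousEP.
- by move=> X Y f; apply/continuousEP.
- by move=> X Y Z W h g f; apply/continuousEP.
Defined.

Definition subbase_space (T : choiceType) (B : set (set T)) : Type := T.

HB.instance Definition _ (T : choiceType) (B : set (set T)) :=
  Choice.on (subbase_space B).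
HB.instance Definition _ (T : choiceType) (B : set (set T)) :=
  isSubBaseTopological.Build (subbase_space B) B id.

Section subbase.
Variables (T : choiceType) (B : set (set T)).

Lemma subbase_open (A : set T) : B A -> @open (subbase_space B) A.
Proof.
move=> BA; exists [set A]; last by rewrite bigcup_set1.
by move=> _ ->; apply: (@finI_from1 _ _ B id).
Qed.

Lemma subbase_cvg (F : set_system T) (p : T) : Filter F ->
  (forall A, B A -> A p -> F A) -> F --> (p : subbase_space B).
Proof.
move=> FF H A; rewrite nbhsE => -[O [[D sD <-] [i Di ip]] OA].
apply: (filterS OA); have [E sE Ei] := sD _ Di.
have Fi : F i.
  rewrite -Ei; apply: filter_bigI => k kE; apply: H.
    by have := sE _ kE; rewrite inE.
  by move: ip; rewrite -Ei; apply.
by apply: filterS Fi => x ix; exists i.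
Qed.
End subbase.

Lemma subbase_continuous (X : topologicalType) (T : choiceType)
    (B : set (set T)) (f : X -> subbase_space B) :
  (forall A, B A -> open (f @^-1` A)) -> continuous f.
Proof.
move=> H x; apply: subbase_cvg => A BA Afx.
by apply: open_nbhs_nbhs; split => //; exact: H.
Qed.

Definition saturated (X : topologicalType) (Q : set X) :=
  Q = \bigcap_(U in [set U : set X | open U /\ Q `<=` U]) U.

Definition is_lens (X : topologicalType) (L : set X) :=
  L !=set0 /\ exists Q C : set X,
    [/\ compact Q, saturated Q, closed C & L = Q `&` C].

Record lens (X : topologicalType) := Lens {
  lens_set :> set X;
  lensP : is_lens lens_set }.

Section vietoris_topology.
Variable X : topologicalType.

Definition vbox (U : set X) : set (lens X) := [set L : lens X | L `<=` U].
Definition vdiamond (U : set X) : set (lens X) :=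
  [set L : lens X | L `&` U !=set0].

Definition lens_subbase : set (set (lens X)) :=
  [set A | exists2 U, open U & A = vbox U \/ A = vdiamond U].

HB.instance Definition _ := gen_eqMixin (lens X).
HB.instance Definition _ := gen_choiceMixin (lens X).
HB.instance Definition _ :=
  Topological.copy (lens X) (subbase_space lens_subbase).
End vietoris_topology.

Lemma lens_eq (X : topologicalType) (K L : lens X) :
  (K = L :> set X) -> K = L.
Proof.
case: K L => [K hK] [L hL] /= e; subst L.
by rewrite (Prop_irrelevance hK hL).
Qed.

Lemma khaus_separate (X : khaus) (x : X) (L : set X) :
  closed L -> ~ L x ->
  exists U V, [/\ open_nbhs x U, open V, L `<=` V & U `&` V = set0].
Proof.
move=> cL nLx; have hX := @khaus_hausdorff X.
have cx : closed [set x].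
  by apply: accessible_closed_set1; exact: hausdorff_accessible.
have [|W xW WL] := compact_normal hX (@khaus_compact X) cx (t := ~` L).
  apply/set_nbhsP; exists (~` L); split => //; first exact: closed_openC.
  by move=> _ ->.
exists (interior W), (~` closure W); split.
- by split; [exact: open_interior|exact: xW].
- by apply: closed_openC; exact: closed_closure.
- by move=> y Ly /WL.
- apply/seteqP; split=> // y [/interior_subset Wy]; apply.
  exact: subset_closure.
Qed.

Lemma saturatedT1 (X : khaus) (Q : set X) : saturated Q.
Proof.
apply/seteqP; split=> [x Qx U [_]|x Hx]; first by apply.
apply: contrapT => nQx; have := Hx (~` [set x]); apply => //; split.
  by rewrite openC; apply: accessible_closed_set1;
     exact/hausdorff_accessible/khaus_hausdorff.
by move=> y Qy yx; apply: nQx; rewrite -yx.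
Qed.

Lemma is_lensE (X : khaus) (L : set X) :
  is_lens L <-> L !=set0 /\ compact L.
Proof.
split=> -[L0 LL]; split => //.
  have [Q [C [cQ _ cC ->]]] := LL; exact: compact_closedI.
exists L, setT; split; rewrite ?setIT//; first exact: saturatedT1.
Qed.

Lemma lens_compact (X : khaus) (L : lens X) : compact L.
Proof. by have [] := (is_lensE L).1 (lensP L). Qed.

Lemma lens_closed (X : khaus) (L : lens X) : closed L.
Proof. exact: (compact_closed (@khaus_hausdorff X) (@lens_compact X L)). Qed.

Lemma vbox_open (X : topologicalType) (U : set X) : open U -> open (vbox U).
Proof.
by move=> oU; apply: (@subbase_open _ (@lens_subbase X)); exists U => //; left.
Qed.

Lemma vdiamond_open (X : topologicalType) (U : set X) :
  open U -> open (vdiamond U).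
Proof.
by move=> oU; apply: (@subbase_open _ (@lens_subbase X)); exists U => //; right.
Qed.

Lemma lens_continuous (X Y : topologicalType) (f : Y -> lens X) :
  (forall U, open U -> open (f @^-1` vbox U)) ->
  (forall U, open U -> open (f @^-1` vdiamond U)) -> continuous f.
Proof.
move=> fb fd; apply: (@subbase_continuous _ _ (@lens_subbase X)).
by move=> A [U oU [->|->]]; [exact: fb|exact: fd].
Qed.

Lemma compact_ideal (X : topologicalType) (K : set X) (G : set (set X)) :
  compact K -> G set0 ->
  (forall A B, A `<=` B -> G B -> G A) ->
  (forall A B, G A -> G B -> G (A `|` B)) ->
  (forall x, K x -> exists2 U, nbhs x U & G U) -> G K.
Proof.
move=> cK G0 Gsub GU Gloc; apply: contrapT => nGK.
pose F := [set A : set X | G (K `\` A)].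
have FF : ProperFilter F.
  split; first by rewrite /F /= setD0.
  split; first by rewrite /F /= setDT.
  - by move=> A B FA FB; rewrite /F /= setDIr; exact: GU.
  - by move=> A B AB; apply: Gsub; exact: setDS.
have [|x [Kx clx]] := cK F FF; first by rewrite /F /= setDv.
have [U xU GUx] := Gloc _ Kx.
have [|y [nUy Uy]] := clx (~` U) U _ xU; last exact: nUy.
by apply: Gsub GUx => y [_ /contrapT].
Qed.

Lemma vdiamond_cover (X : topologicalType) (F : set_system (lens X))
    (K : set X) : UltraFilter F -> compact K ->
  (forall x, K x -> exists2 U, open_nbhs x U & ~ F (vdiamond U)) ->
  F (~` vdiamond K).
Proof.
move=> UF cK H.
apply: (@compact_ideal X K [set V : set X | F (~` vdiamond V)]) => //=.
- by apply: (filterS _ filterT) => L _ [x []].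
- move=> A B AB; apply: filterS => L nB [x [Lx Ax]]; apply: nB.
  by exists x; split => //; exact: AB.
- move=> A B fA fB; apply: filterS (filterI fA fB).
  by move=> L [nA nB] [x [Lx [Ax|Bx]]]; [apply: nA|apply: nB]; exists x.
- move=> x Kx; have [U xU nFU] := H _ Kx.
  exists U; first exact: open_nbhs_nbhs.
  by have [//|] := in_ultra_setVsetC (vdiamond U) UF.
Qed.

Lemma lens_space_compact (X : khaus) : compact [set: lens X].
Proof.
rewrite compact_ultra => F UF _.
pose L0 := [set x : X | forall U, open_nbhs x U -> F (vdiamond U)].
have cL0 K : compact K -> K `&` L0 = set0 -> F (~` vdiamond K).
  move=> cK K0; apply: vdiamond_cover => // x Kx; apply: contrapT => nU.
  have : (K `&` L0) x; last by rewrite K0.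
  by split => // U xU; apply: contrapT => nF; apply: nU; exists U.
have L0ne : L0 !=set0.
  apply: contrapT => nL0.
  have := cL0 setT (@khaus_compact X).
  rewrite setTI => /(_ _) H.
  have /H : L0 = set0 by apply/eqP; apply: contrapT => /negP/set0P.
  move=> FN; apply: (@filter_not_empty _ F); apply: filterS FN => L; apply.
  by have [[x Lx] _] := lensP L; exists x.
have clL0 : closed L0.
  move=> x clx U [oU Ux]; have [|y [Ly Uy]] := clx U.
    by apply: open_nbhs_nbhs.
  exact: Ly.
have lL0 : is_lens L0.
  apply/is_lensE; split => //.
  by apply: (subclosed_compact clL0 (@khaus_compact X)).
exists (Lens lL0); split => //.
apply: (@subbase_cvg _ (@lens_subbase X)) => A [U oU [->|->]].
- rewrite /vbox /= => LU.
  have cU : compact (~` U).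
    by apply: (subclosed_compact _ (@khaus_compact X)) => //; exact: open_closedC.
  have := cL0 _ cU; apply: (fun P Q R => @filterS _ F _ _ _ P (R Q)).
    by move=> L nL x Lx; apply: contrapT => nU; apply: nL; exists x.
  by apply/seteqP; split=> // x [nU /LU].
- by move=> -[x [Lx Ux]]; exact: Lx.
Qed.

Lemma lens_separate (X : khaus) (K L : lens X) (x : X) :
  lens_set K x -> ~ lens_set L x ->
  exists A B : set (lens X), [/\ open A, open B, A K, B L & A `&` B = set0].
Proof.
move=> Kx nLx.
have [U [V [[oU Ux] oV LV UV]]] := khaus_separate (@lens_closed _ L) nLx.
exists (vdiamond U), (vbox V); split => //.
- exact: vdiamond_open.
- exact: vbox_open.
- by exists x.
- apply/seteqP; split => // M [[y [My Uy]] /(_ _ My) Vy].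
  by have : (U `&` V) y by []; rewrite UV.
Qed.

Lemma lens_space_hausdorff (X : khaus) : hausdorff_space (lens X).
Proof.
rewrite open_hausdorff => K L /eqP KL.
have [[x [Kx nLx]]|nKL] := pselect (exists x, lens_set K x /\ ~ lens_set L x).
  have [A [B [oA oB AK BL AB]]] := lens_separate Kx nLx.
  by exists (A, B); rewrite /= ?inE//; split => //; apply/eqP.
have [[x [Lx nKx]]|nLK] := pselect (exists x, lens_set L x /\ ~ lens_set K x).
  have [A [B [oA oB AK BL AB]]] := lens_separate Lx nKx.
  by exists (B, A); rewrite /= ?inE//; split => //; apply/eqP; rewrite -AB setIC.
exfalso; apply: KL; apply: lens_eq; apply/seteqP; split=> x Hx; apply: contrapT => nx.
- by apply: nKL; exists x.
- by apply: nLK; exists x.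
Qed.

Definition lens_khaus (X : khaus) : khaus :=
  KHausSpace (@lens_space_compact X) (@lens_space_hausdorff X).

Section vietoris_maps.
Variables (X Y : khaus).

Fact lens_map_subproof (f : continuousType X Y) (L : lens X) :
  is_lens (f @` L).
Proof.
apply/is_lensE; split; first by have [[x Lx] _] := lensP L; exists (f x), x.
apply: continuous_compact; last exact: lens_compact.
by apply: continuous_subspaceT; exact: cts_fun.
Qed.

Definition lens_map (f : continuousType X Y) (L : lens X) : lens Y :=
  Lens (lens_map_subproof f L).

Lemma lens_map_continuous (f : continuousType X Y) : continuous (lens_map f).
Proof.
have cf := @cts_fun _ _ f.
apply: lens_continuous => U oU.
- rewrite (_ : _ @^-1` _ = vbox (f @^-1` U)).
    by apply: vbox_open; exact: open_comp.
  apply/seteqP; split=> L H x Lx; first by apply: H; exists x.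
  by have [y Ly <-] := Lx; exact: H.
- rewrite (_ : _ @^-1` _ = vdiamond (f @^-1` U)).
    by apply: vdiamond_open; exact: open_comp.
  apply/seteqP; split=> L [x []]; first by move=> [y Ly <-] Uy; exists y.
  by move=> Lx Ux; exists (f x); split => //; exists x.
Qed.

Fact lens_unit_subproof (x : X) : is_lens [set x].
Proof. by apply/is_lensE; split; [exists x|exact: compact_set1]. Qed.

Definition lens_unit (x : X) : lens X := Lens (lens_unit_subproof x).

Lemma lens_unit_continuous : continuous lens_unit.
Proof.
apply: lens_continuous => U oU.
- rewrite (_ : _ @^-1` _ = U)//; apply/seteqP; split=> x; first exact.
  by move=> Ux _ ->.
- rewrite (_ : _ @^-1` _ = U)//; apply/seteqP; split=> x.
  by move=> [_ [->]].
  by move=> Ux; exists x.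
Qed.

Fact lens_mult_subproof (LL : lens (lens_khaus X)) :
  is_lens (\bigcup_(L in (LL : set (lens X))) (L : set X)).
Proof.
apply/is_lensE; split.
  have [[L LLL] _] := lensP LL; have [[x Lx] _] := lensP L.
  by exists x, L.
apply: (subclosed_compact _ (@khaus_compact X)) => // x clx.
have cLL := @lens_compact (lens_khaus X) LL.
apply: contrapT => nx.
have : exists2 U, nbhs x U & forall L, lens_set LL L -> ~ (L `&` U !=set0).
  apply: (@compact_ideal _ _ [set S : set (lens X) | exists2 U, nbhs x U &
    forall L, S L -> ~ (L `&` U !=set0)] cLL) => /=.
  - by exists setT; [exact: filterT|].
  - by move=> A B AB [U xU UB]; exists U => // L /AB; exact: UB.
  - move=> A B [U xU UA] [V xV VB]; exists (U `&` V); first exact: filterI.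
    move=> L [/UA|/VB] nL [y [Ly [Uy Vy]]]; by apply: nL; exists y.
  - move=> L LLL.
    have [|U [V [xU oV LV UV]]] := @khaus_separate _ x _ (@lens_closed _ L).
      by move=> Lx; apply: nx; exists L.
    exists (vbox V).
      by apply: open_nbhs_nbhs; split => //; exact: vbox_open.
    exists U; first exact: open_nbhs_nbhs.
    move=> M MV [y [/MV Vy Uy]].
    by have : (U `&` V) y by []; rewrite UV.
case=> U xU UE; have [y [[L LLL Ly] Uy]] := clx _ xU.
by apply: (UE L LLL); exists y.
Qed.

Definition lens_mult (LL : lens (lens_khaus X)) : lens X :=
  Lens (lens_mult_subproof LL).

Lemma lens_mult_continuous :
  continuous (lens_mult : lens (lens_khaus X) -> lens X).
Proof.
apply: lens_continuous => U oU.
- rewrite (_ : _ @^-1` _ = @vbox (lens_khaus X) (vbox U)).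
    by apply: vbox_open; exact: vbox_open.
  apply/seteqP; split=> LL H.
    by move=> L LLL x Lx; apply: H; exists L.
  by move=> x [L LLL Lx]; exact: (H L LLL x Lx).
- rewrite (_ : _ @^-1` _ = @vdiamond (lens_khaus X) (vdiamond U)).
    by apply: vdiamond_open; exact: vdiamond_open.
  apply/seteqP; split=> LL.
    by move=> [x [[L LLL Lx] Ux]]; exists L; split => //; exists x.
  by move=> [L [LLL [x [Lx Ux]]]]; exists x; split => //; exists L.
Qed.
End vietoris_maps.

Definition Plv_functor : functor KHaus KHaus.
Proof.
refine (@Functor KHaus KHaus lens_khaus
  (fun X Y f => cmap (@lens_map_continuous X Y f)) _ _).
- move=> X; apply/continuousEP => L; apply: lens_eq => /=.
  by rewrite image_id.
- move=> X Y Z g f; apply/continuousEP => L; apply: lens_eq => /=.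
  by rewrite image_comp.
Defined.

Definition Plv_eta : nat_trans (functor_id KHaus) Plv_functor.
Proof.
refine (@NatTrans KHaus KHaus (functor_id KHaus) Plv_functor
  (fun X => cmap (@lens_unit_continuous X)) _).
move=> X Y f; apply/continuousEP => x; apply: lens_eq => /=.
by rewrite image_set1.
Defined.

Definition Plv_mu : nat_trans (functor_comp Plv_functor Plv_functor) Plv_functor.
Proof.
refine (@NatTrans KHaus KHaus (functor_comp Plv_functor Plv_functor) Plv_functor
  (fun X => cmap (@lens_mult_continuous X)) _).
move=> X Y f; apply/continuousEP => LL; apply: lens_eq => /=.
by rewrite bigcup_image image_bigcup.
Defined.

Definition Plv : monad KHaus.
Proof.
refine (@Monad KHaus Plv_functor Plv_eta Plv_mu _ _ _).
- move=> X; apply/continuousEP => L; apply: lens_eq => /=.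
  by rewrite bigcup_image; apply/seteqP; split=> [x [y Ly ->]//|x Lx]; exists x.
- move=> X; apply/continuousEP => L; apply: lens_eq => /=.
  by rewrite bigcup_set1.
- move=> X; apply/continuousEP => L; apply: lens_eq => /=.
  rewrite bigcup_image; apply/seteqP; split=> x.
    by move=> [A LA [B AB Bx]]; exists B => //; exists A.
  by move=> [B [A LA AB] Bx]; exists A => //; exists B.
Defined.

Local Open Scope ereal_scope.

(* The values of lsc functions and of previsions lie in [0, +oo], encoded as the
   nonnegative elements of \bar R; in \bar R, 0 * +oo = 0. *)
Record lsc (R : realType) (X : topologicalType) := Lsc {
  lsc_fun :> X -> \bar R;
  lsc_ge0 : forall x, 0 <= lsc_fun x;
  lsc_lower_semicontinuous : lower_semicontinuous lsc_fun }.

Lemma lsc_eq (R : realType) (X : topologicalType) (h k : lsc R X) :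
  h =1 k -> h = k.
Proof.
case: h k => [h h0 hl] [k k0 kl] /= /funext e; subst k.
by rewrite (Prop_irrelevance h0 k0) (Prop_irrelevance hl kl).
Qed.

Section lsc_operations.
Variables (R : realType) (X : topologicalType).
Implicit Types h k : lsc R X.

Definition lsc_le h k := forall x, h x <= k x.

Fact lsc_one_lsc : lower_semicontinuous (fun _ : X => 1 : \bar R).
Proof. by move=> x a a1; exists setT => //; exact: filterT. Qed.

Definition lsc_one : lsc R X := Lsc (fun _ => lee01) lsc_one_lsc.

Fact lsc_scale_ge0 (a : R) (a0 : (0 <= a)%R) h x : 0 <= a%:E * h x.
Proof. by rewrite mule_ge0// ?lee_fin//; exact: lsc_ge0. Qed.

Fact lsc_scale_lsc (a : R) (a0 : (0 <= a)%R) h :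
  lower_semicontinuous (fun x => a%:E * h x).
Proof.
move: a0; rewrite le_eqVlt => /predU1P[<- x b|a0 x b].
  by rewrite mul0e => b0; exists setT; [exact: filterT|move=> y _; rewrite mul0e].
rewrite muleC -lte_pdivrMr// => bh.
have [V xV VH] := lsc_lower_semicontinuous bh.
by exists V => // y /VH; rewrite EFinM lte_pdivrMr// muleC.
Qed.

Definition lsc_scale (a : R) (a0 : (0 <= a)%R) h : lsc R X :=
  Lsc (@lsc_scale_ge0 a a0 h) (@lsc_scale_lsc a a0 h).

Fact lsc_add_ge0 h k x : 0 <= h x + k x.
Proof. by rewrite adde_ge0//; exact: lsc_ge0. Qed.

Lemma lte_add_split (a : R) (u v : \bar R) : 0 <= u -> 0 <= v -> a%:E < u + v ->
  exists b c : R, [/\ b%:E < u, c%:E < v & (a <= b + c)%R].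
Proof.
case: u => [u||]//; case: v => [v||]//; rewrite ?lee_fin => u0 v0 auv.
- rewrite -EFinD lte_fin in auv.
  exists (u - (u + v - a) / 2)%R, (v - (u + v - a) / 2)%R.
  by split; rewrite ?lte_fin; lra.
- by exists (u - 1)%R, (a - u + 1)%R; split; rewrite ?ltry// ?lte_fin; lra.
- by exists (a - v + 1)%R, (v - 1)%R; split; rewrite ?ltry// ?lte_fin; lra.
- by exists a, 0%R; split; rewrite ?ltry// addr0.
Qed.

Fact lsc_add_lsc h k : lower_semicontinuous (fun x => h x + k x).
Proof.
move=> x a /(lte_add_split (lsc_ge0 h x) (lsc_ge0 k x)) [b [c [bh ck abc]]].
have [V xV VH] := lsc_lower_semicontinuous bh.
have [W xW WH] := lsc_lower_semicontinuous ck.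
exists (V `&` W); first exact: filterI.
move=> y [/VH bhy /WH cky].
by apply: (@le_lt_trans _ _ (b%:E + c%:E)); [rewrite -EFinD lee_fin|exact: lteD].
Qed.

Definition lsc_add h k : lsc R X := Lsc (@lsc_add_ge0 h k) (@lsc_add_lsc h k).

Definition lsc_lub (D : set (lsc R X)) h :=
  (forall k, D k -> lsc_le k h) /\
  (forall k, (forall g, D g -> lsc_le g k) -> lsc_le h k).

Definition lsc_directed (D : set (lsc R X)) :=
  D !=set0 /\ (forall h k, D h -> D k ->
    exists g, [/\ D g, lsc_le h g & lsc_le k g]).

Section lsc_sup.
Variables (D : set (lsc R X)) (D0 : D !=set0).

Fact lsc_sup_ge0 x : 0 <= ereal_sup [set (g : lsc R X) x | g in D].
Proof.
have [g Dg] := D0; apply: (@le_trans _ _ (g x)); first exact: lsc_ge0.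
by apply: ereal_sup_ubound; exists g.
Qed.

Fact lsc_sup_lsc :
  lower_semicontinuous (fun x => ereal_sup [set (g : lsc R X) x | g in D]).
Proof.
move=> x a /ereal_sup_gt[_ [g Dg <-] /lsc_lower_semicontinuous[V xV VH]].
exists V => // y /VH /lt_le_trans; apply.
by apply: ereal_sup_ubound; exists g.
Qed.

Definition lsc_sup : lsc R X := Lsc lsc_sup_ge0 lsc_sup_lsc.
End lsc_sup.

Lemma lsc_lubP (D : set (lsc R X)) h : D !=set0 ->
  lsc_lub D h <-> forall x, h x = ereal_sup [set (g : lsc R X) x | g in D].
Proof.
move=> D0; split=> [[ub lub] x|hE].
  apply/eqP; rewrite eq_le; apply/andP; split.
    apply: (lub (lsc_sup D0)) => g Dg y.
    by apply: ereal_sup_ubound; exists g.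
  by apply: ge_ereal_sup => _ [g Dg <-]; exact: ub.
split=> [g Dg x|k kub x].
  by rewrite hE; apply: ereal_sup_ubound; exists g.
by rewrite hE; apply: ge_ereal_sup => _ [g Dg <-]; exact: kub.
Qed.

Definition scott_continuous (F : lsc R X -> \bar R) :=
  (forall h k, lsc_le h k -> F h <= F k) /\
  (forall D h, lsc_directed D -> lsc_lub D h -> F h = ereal_sup (F @` D)).

Record is_prevision (F : lsc R X -> \bar R) : Prop := IsPrevision {
  prevision_ge0 : forall h, 0 <= F h;
  prevision_scott : scott_continuous F;
  prevision_scale : forall (a : R) (a0 : (0 <= a)%R) h,
    F (lsc_scale a0 h) = a%:E * F h }.

Definition linear_prevision (F : lsc R X -> \bar R) :=
  is_prevision F /\ forall h k, F (lsc_add h k) = F h + F k.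
Definition superlinear_prevision (F : lsc R X -> \bar R) :=
  is_prevision F /\ forall h k, F h + F k <= F (lsc_add h k).
Definition sublinear_prevision (F : lsc R X -> \bar R) :=
  is_prevision F /\ forall h k, F (lsc_add h k) <= F h + F k.
Definition normalized (F : lsc R X -> \bar R) :=
  forall h, F (lsc_add lsc_one h) = 1 + F h.
End lsc_operations.

Arguments lsc_one {R X}.

Section lsc_maps.
Variables (R : realType).

Fact lsc_comp_lsc (X Y : topologicalType) (f : continuousType X Y)
  (h : lsc R Y) : lower_semicontinuous (fun x => h (f x)).
Proof.
move=> x a /lsc_lower_semicontinuous[V xV VH].
by exists (f @^-1` V) => [|y /VH//]; exact: (@cts_fun _ _ f x).
Qed.

Definition lsc_comp (X Y : topologicalType) (f : continuousType X Y)
  (h : lsc R Y) : lsc R X :=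
  Lsc (fun x => lsc_ge0 h (f x)) (@lsc_comp_lsc X Y f h).

Lemma prevision_precomp (X Y : topologicalType) (F : lsc R X -> \bar R)
    (phi : lsc R Y -> lsc R X) :
  is_prevision F ->
  (forall (a : R) (a0 : (0 <= a)%R) h,
    phi (lsc_scale a0 h) = lsc_scale a0 (phi h)) ->
  (forall h k, lsc_le h k -> lsc_le (phi h) (phi k)) ->
  (forall D h, lsc_directed D -> lsc_lub D h ->
    forall x, phi h x = ereal_sup [set phi g x | g in D]) ->
  is_prevision (fun h => F (phi h)).
Proof.
move=> [F0 [Fm Fs] Fa] pa pm ps; split=> //; last by move=> a a0 h; rewrite pa.
split=> [h k hk|D h dD lD]; first exact/Fm/pm.
have [D0 DD] := dD.
rewrite (Fs (phi @` D)) ?image_comp//.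
- split; first by have [g Dg] := D0; exists (phi g), g.
  move=> _ _ [g Dg <-] [k Dk <-]; have [l [Dl gl kl]] := DD _ _ Dg Dk.
  by exists (phi l); split; [exists l|exact: pm|exact: pm].
- apply/lsc_lubP; first by have [g Dg] := D0; exists (phi g), g.
  by move=> x; rewrite (ps _ _ dD lD) image_comp.
Qed.

Lemma lsc_comp_prevision (X Y : topologicalType) (f : continuousType X Y)
    (F : lsc R X -> \bar R) :
  is_prevision F -> is_prevision (fun h => F (lsc_comp f h)).
Proof.
move=> PF; apply: (prevision_precomp PF).
- by move=> a a0 h; apply: lsc_eq.
- by move=> h k hk x; exact: hk.
- by move=> D h [D0 _] /(lsc_lubP _ D0) hE x; rewrite /= hE.
Qed.

Lemma eval_prevision (X : topologicalType) (x : X) :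
  is_prevision (fun h : lsc R X => h x).
Proof.
split=> [h||a a0 h //]; first exact: lsc_ge0.
by split=> [h k //|D h [D0 _] /(lsc_lubP _ D0)].
Qed.
End lsc_maps.

(* A probability valuation nu is identified with the normalized linear prevision
   h |-> \int h dnu. *)
Record linprev (R : realType) (X : topologicalType) := LinPrev {
  linprev_fun :> lsc R X -> \bar R;
  linprevP : linear_prevision linprev_fun;
  linprev_normalized : normalized linprev_fun }.

Section linprev_topology.
Variables (R : realType) (X : topologicalType).

Definition linprev_subbase : set (set (linprev R X)) :=
  [set A | exists (h : lsc R X) (r : R), A = [set F : linprev R X | r%:E < F h]].

HB.instance Definition _ := gen_eqMixin (linprev R X).
HB.instance Definition _ := gen_choiceMixin (linprev R X).
HB.instance Definition _ :=
  Topological.copy (linprev R X) (subbase_space linprev_subbase).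

Lemma linprev_eq (F G : linprev R X) : F =1 G -> F = G.
Proof.
case: F G => [F PF NF] [G PG NG] /= /funext e; subst G.
by rewrite (Prop_irrelevance PF PG) (Prop_irrelevance NF NG).
Qed.

Lemma linprev_open (h : lsc R X) (r : R) :
  open [set F : linprev R X | r%:E < F h].
Proof. by apply: (@subbase_open _ linprev_subbase); exists h, r. Qed.

Lemma linprev_continuous (Y : topologicalType) (f : Y -> linprev R X) :
  (forall h (r : R), open [set y | r%:E < f y h]) -> continuous f.
Proof.
move=> H; apply: (@subbase_continuous _ _ linprev_subbase).
by move=> A [h [r ->]]; exact: H.
Qed.

Fact linprev_eval_lsc (h : lsc R X) :
  lower_semicontinuous (fun F : linprev R X => F h).
Proof. by apply/lower_semicontinuousP => a; exact: linprev_open. Qed.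

Definition linprev_eval (h : lsc R X) : lsc R (linprev R X) :=
  Lsc (fun F : linprev R X => prevision_ge0 (linprevP F).1 h)
    (@linprev_eval_lsc h).
End linprev_topology.

Section linprev_maps.
Variables (R : realType) (X Y : topologicalType).

Fact linprev_map_linear (f : continuousType X Y) (F : linprev R X) :
  linear_prevision (fun h => F (lsc_comp f h)).
Proof.
have [PF LF] := linprevP F; split; first exact: lsc_comp_prevision.
by move=> h k; rewrite -LF; congr (linprev_fun F _); apply: lsc_eq.
Qed.

Fact linprev_map_normalized (f : continuousType X Y) (F : linprev R X) :
  normalized (fun h => F (lsc_comp f h)).
Proof.
move=> h; rewrite -linprev_normalized.
by congr (linprev_fun F _); apply: lsc_eq.
Qed.

Definition linprev_map (f : continuousType X Y) (F : linprev R X) :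
  linprev R Y :=
  LinPrev (linprev_map_linear f F) (linprev_map_normalized f F).

Lemma linprev_map_continuous (f : continuousType X Y) :
  continuous (linprev_map f).
Proof. by apply: linprev_continuous => h r; exact: linprev_open. Qed.

Fact linprev_unit_linear (x : X) : linear_prevision (fun h : lsc R X => h x).
Proof. by split; first exact: eval_prevision. Qed.

Definition linprev_unit (x : X) : linprev R X :=
  LinPrev (linprev_unit_linear x) (fun _ => erefl).

Lemma linprev_unit_continuous : continuous linprev_unit.
Proof.
apply: linprev_continuous => h r.
exact: (lower_semicontinuousP _).1 (@lsc_lower_semicontinuous _ _ h) r.
Qed.

Fact linprev_mult_linear (FF : linprev R (linprev R X)) :
  linear_prevision (fun h => FF (linprev_eval h)).
Proof.
have [PF LF] := linprevP FF; split.
  apply: (prevision_precomp PF).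
  - move=> a a0 h; apply: lsc_eq => F /=.
    exact: prevision_scale (linprevP F).1 _ _ _.
  - by move=> h k hk F; have [[_ [+ _] _] _] := linprevP F; apply.
  - by move=> D h dD hD F; have [[_ [_ +] _] _] := linprevP F; exact.
move=> h k; rewrite -LF; congr (linprev_fun FF _); apply: lsc_eq => F /=.
exact: (linprevP F).2.
Qed.

Fact linprev_mult_normalized (FF : linprev R (linprev R X)) :
  normalized (fun h => FF (linprev_eval h)).
Proof.
move=> h; rewrite -linprev_normalized; congr (linprev_fun FF _).
by apply: lsc_eq => F /=; exact: linprev_normalized.
Qed.

Definition linprev_mult (FF : linprev R (linprev R X)) : linprev R X :=
  LinPrev (linprev_mult_linear FF) (linprev_mult_normalized FF).

Lemma linprev_mult_continuous : continuous linprev_mult.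
Proof. by apply: linprev_continuous => h r; exact: linprev_open. Qed.
End linprev_maps.

Record fork (R : realType) (X : topologicalType) := Fork {
  fork_lo : lsc R X -> \bar R;
  fork_up : lsc R X -> \bar R;
  fork_loP : superlinear_prevision fork_lo;
  fork_upP : sublinear_prevision fork_up;
  fork_lo_normalized : normalized fork_lo;
  fork_up_normalized : normalized fork_up;
  fork_lo_add : forall h k, fork_lo (lsc_add h k) <= fork_lo h + fork_up k;
  fork_add_up : forall h k, fork_lo h + fork_up k <= fork_up (lsc_add h k) }.

Section fork_topology.
Variables (R : realType) (X : topologicalType).

Definition fork_subbase : set (set (fork R X)) :=
  [set A | exists (h : lsc R X) (r : R),
    A = [set F | r%:E < fork_lo F h] \/ A = [set F | r%:E < fork_up F h]].

HB.instance Definition _ := gen_eqMixin (fork R X).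
HB.instance Definition _ := gen_choiceMixin (fork R X).
HB.instance Definition _ :=
  Topological.copy (fork R X) (subbase_space fork_subbase).

Lemma fork_eq (F G : fork R X) :
  fork_lo F =1 fork_lo G -> fork_up F =1 fork_up G -> F = G.
Proof.
case: F G => [F F' a1 a2 a3 a4 a5 a6] [G G' b1 b2 b3 b4 b5 b6] /=.
move=> /funext e /funext e'; subst G G'.
by rewrite (Prop_irrelevance a1 b1) (Prop_irrelevance a2 b2)
  (Prop_irrelevance a3 b3) (Prop_irrelevance a4 b4) (Prop_irrelevance a5 b5)
  (Prop_irrelevance a6 b6).
Qed.

Lemma fork_lo_open (h : lsc R X) (r : R) : open [set F | r%:E < fork_lo F h].
Proof. by apply: (@subbase_open _ fork_subbase); exists h, r; left. Qed.

Lemma fork_up_open (h : lsc R X) (r : R) : open [set F | r%:E < fork_up F h].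
Proof. by apply: (@subbase_open _ fork_subbase); exists h, r; right. Qed.

Lemma fork_continuous (Y : topologicalType) (f : Y -> fork R X) :
  (forall h (r : R), open [set y | r%:E < fork_lo (f y) h]) ->
  (forall h (r : R), open [set y | r%:E < fork_up (f y) h]) -> continuous f.
Proof.
move=> Hlo Hup; apply: (@subbase_continuous _ _ fork_subbase).
by move=> A [h [r [->|->]]]; [exact: Hlo|exact: Hup].
Qed.

Fact fork_lo_eval_lsc (h : lsc R X) : lower_semicontinuous (fun F : fork R X => fork_lo F h).
Proof. by apply/lower_semicontinuousP => a; exact: fork_lo_open. Qed.

Definition fork_lo_eval (h : lsc R X) : lsc R (fork R X) :=
  Lsc (fun F => prevision_ge0 (fork_loP F).1 h) (@fork_lo_eval_lsc h).

Fact fork_up_eval_lsc (h : lsc R X) : lower_semicontinuous (fun F : fork R X => fork_up F h).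
Proof. by apply/lower_semicontinuousP => a; exact: fork_up_open. Qed.

Definition fork_up_eval (h : lsc R X) : lsc R (fork R X) :=
  Lsc (fun F => prevision_ge0 (fork_upP F).1 h) (@fork_up_eval_lsc h).
End fork_topology.

Section fork_maps.
Variables (R : realType) (X Y : topologicalType).

Definition fork_map (f : continuousType X Y) (F : fork R X) : fork R Y.
Proof.
refine (@Fork R Y (fun h => fork_lo F (lsc_comp f h))
  (fun h => fork_up F (lsc_comp f h)) _ _ _ _ _ _).
- split; first exact: lsc_comp_prevision (fork_loP F).1.
  move=> h k; apply: le_trans ((fork_loP F).2 _ _) _.
  by rewrite le_eqVlt (_ : lsc_add _ _ = lsc_comp f (lsc_add h k)) ?eqxx//;
    apply: lsc_eq.
- split; first exact: lsc_comp_prevision (fork_upP F).1.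
  move=> h k; apply: le_trans ((fork_upP F).2 _ _).
  by rewrite le_eqVlt (_ : lsc_add _ _ = lsc_comp f (lsc_add h k)) ?eqxx//;
    apply: lsc_eq.
- move=> h; rewrite -fork_lo_normalized; congr (fork_lo F _).
  exact: lsc_eq.
- move=> h; rewrite -fork_up_normalized; congr (fork_up F _).
  exact: lsc_eq.
- move=> h k; rewrite (_ : lsc_comp f _ =
    lsc_add (lsc_comp f h) (lsc_comp f k)); last exact: lsc_eq.
  exact: fork_lo_add.
- move=> h k; rewrite (_ : lsc_comp f (lsc_add h k) =
    lsc_add (lsc_comp f h) (lsc_comp f k)); last exact: lsc_eq.
  exact: fork_add_up.
Defined.

Lemma fork_map_continuous (f : continuousType X Y) : continuous (fork_map f).
Proof.
by apply: fork_continuous => h r; [exact: fork_lo_open|exact: fork_up_open].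
Qed.

Definition fork_unit (x : X) : fork R X.
Proof.
refine (@Fork R X (fun h => h x) (fun h => h x) _ _ _ _ _ _) => //.
- by split; first exact: eval_prevision.
- by split; first exact: eval_prevision.
Defined.

Lemma fork_unit_continuous : continuous fork_unit.
Proof.
apply: fork_continuous => h r;
exact: (lower_semicontinuousP _).1 (@lsc_lower_semicontinuous _ _ h) r.
Qed.

Let lo_mono (Z : topologicalType) (F : fork R Z) h k :
  lsc_le h k -> fork_lo F h <= fork_lo F k.
Proof. by have [[_ [+ _] _] _] := fork_loP F; apply. Qed.

Let up_mono (Z : topologicalType) (F : fork R Z) h k :
  lsc_le h k -> fork_up F h <= fork_up F k.
Proof. by have [[_ [+ _] _] _] := fork_upP F; apply. Qed.

Definition fork_mult (FF : fork R (fork R X)) : fork R X.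
Proof.
refine (@Fork R X (fun h => fork_lo FF (fork_lo_eval h))
  (fun h => fork_up FF (fork_up_eval h)) _ _ _ _ _ _).
- split.
    apply: (prevision_precomp (fork_loP FF).1).
    + move=> a a0 h; apply: lsc_eq => F /=.
      exact: prevision_scale (fork_loP F).1 _ _ _.
    + by move=> h k hk F; exact: lo_mono.
    + by move=> D h dD hD F; have [[_ [_ +] _] _] := fork_loP F; exact.
  move=> h k; apply: le_trans ((fork_loP FF).2 _ _) _.
  by apply: lo_mono => F /=; exact: (fork_loP F).2.
- split.
    apply: (prevision_precomp (fork_upP FF).1).
    + move=> a a0 h; apply: lsc_eq => F /=.
      exact: prevision_scale (fork_upP F).1 _ _ _.
    + by move=> h k hk F; exact: up_mono.
    + by move=> D h dD hD F; have [[_ [_ +] _] _] := fork_upP F; exact.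
  move=> h k; apply: le_trans ((fork_upP FF).2 _ _).
  by apply: up_mono => F /=; exact: (fork_upP F).2.
- move=> h; rewrite -fork_lo_normalized; congr (fork_lo FF _).
  by apply: lsc_eq => F; exact: fork_lo_normalized.
- move=> h; rewrite -fork_up_normalized; congr (fork_up FF _).
  by apply: lsc_eq => F; exact: fork_up_normalized.
- move=> h k; apply: le_trans (fork_lo_add _ _ _).
  by apply: lo_mono => F /=; exact: fork_lo_add.
- move=> h k; apply: le_trans (fork_add_up _ _ _) _.
  by apply: up_mono => F /=; exact: fork_add_up.
Defined.

Lemma fork_mult_continuous : continuous fork_mult.
Proof.
by apply: fork_continuous => h r; [exact: fork_lo_open|exact: fork_up_open].
Qed.
End fork_maps.

Local Close Scope ereal_scope.

Record cpos (R : realType) (X : topologicalType) := CPos {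
  cpos_fun :> X -> R;
  cpos_cont : continuous cpos_fun;
  cpos_ge0 : forall x, 0 <= cpos_fun x }.

Section cpos_operations.
Variables (R : realType) (X : topologicalType).
Implicit Types g : cpos R X.

Fact cpos_cst_cont (c : R) : continuous (fun _ : X => c).
Proof. by move=> x; exact: cvg_cst. Qed.

Definition cpos_cst (c : R) (c0 : 0 <= c) : cpos R X :=
  CPos (@cpos_cst_cont c) (fun _ => c0).

Fact cpos_add_cont g1 g2 : continuous (fun x => g1 x + g2 x).
Proof. by move=> x; apply: cvgD; exact: cpos_cont. Qed.

Definition cpos_add g1 g2 : cpos R X :=
  CPos (@cpos_add_cont g1 g2) (fun x => addr_ge0 (cpos_ge0 g1 x) (cpos_ge0 g2 x)).

Fact cpos_scale_cont (a : R) g : continuous (fun x => a * g x).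
Proof. by move=> x; apply: cvgM; [exact: cvg_cst|exact: cpos_cont]. Qed.

Definition cpos_scale (a : R) (a0 : 0 <= a) g : cpos R X :=
  CPos (@cpos_scale_cont a g) (fun x => mulr_ge0 a0 (cpos_ge0 g x)).

Fact cpos_max_cont g1 g2 : continuous (fun x => Num.max (g1 x) (g2 x)).
Proof.
by move=> x; apply: (@continuous_max _ _ (cpos_fun g1) (cpos_fun g2));
  exact: cpos_cont.
Qed.

Fact cpos_max_ge0 g1 g2 x : 0 <= Num.max (g1 x) (g2 x).
Proof. by rewrite le_max cpos_ge0. Qed.

Definition cpos_max g1 g2 : cpos R X :=
  CPos (@cpos_max_cont g1 g2) (@cpos_max_ge0 g1 g2).

Fact cpos_sub_cont g (c : R) : continuous (fun x => Num.max (g x - c) 0).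
Proof.
move=> x; apply: (@continuous_max _ _ (fun x => g x - c) (fun=> 0)).
  by apply: cvgB; [exact: cpos_cont|exact: cvg_cst].
exact: cvg_cst.
Qed.

Fact cpos_sub_ge0 g (c : R) x : 0 <= Num.max (g x - c) 0.
Proof. by rewrite le_max lexx orbT. Qed.

Definition cpos_sub g (c : R) : cpos R X :=
  CPos (@cpos_sub_cont g c) (@cpos_sub_ge0 g c).

Fact cpos_compl_cont g (M : R) : continuous (fun x => Num.max (M - g x) 0).
Proof.
move=> x; apply: (@continuous_max _ _ (fun x => M - g x) (fun=> 0)).
  by apply: cvgB; [exact: cvg_cst|exact: cpos_cont].
exact: cvg_cst.
Qed.

Fact cpos_compl_ge0 g (M : R) x : 0 <= Num.max (M - g x) 0.
Proof. by rewrite le_max lexx orbT. Qed.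

(* Truncated so as to be nonnegative for every M; equal to M - g when g <= M. *)
Definition cpos_compl g (M : R) : cpos R X :=
  CPos (@cpos_compl_cont g M) (@cpos_compl_ge0 g M).

Fact cpos_lsc_ge0 g x : (0 <= (g x)%:E)%E.
Proof. by rewrite lee_fin cpos_ge0. Qed.

Fact cpos_lsc_lsc g : lower_semicontinuous (fun x => (g x)%:E).
Proof.
apply/lower_semicontinuousP => a.
rewrite (_ : [set _ | _] = g @^-1` [set y | a < y]).
  by apply: open_comp; [move=> x _; exact: cpos_cont|exact: open_gt].
by apply/seteqP; split=> x /=; rewrite lte_fin.
Qed.

Definition cpos_lsc g : lsc R X := Lsc (@cpos_lsc_ge0 g) (@cpos_lsc_lsc g).

Definition cpos_below (h : lsc R X) : set (cpos R X) :=
  [set g | lsc_le (cpos_lsc g) h].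

Lemma cpos_below_max (h : lsc R X) g1 g2 :
  cpos_below h g1 -> cpos_below h g2 -> cpos_below h (cpos_max g1 g2).
Proof.
move=> b1 b2 x /=; rewrite EFin_max.
by rewrite ge_max; apply/andP; split; [exact: b1|exact: b2].
Qed.
End cpos_operations.

Section approximation.
Variables (R : realType) (X : khaus).
Implicit Types (g : cpos R X) (h : lsc R X).

Lemma khaus_urysohn (x : X) (B : set X) : closed B -> ~ B x ->
  exists f : cpos R X, [/\ f x = 1, forall y, B y -> f y = 0 &
    forall y, f y <= 1].
Proof.
move=> cB nBx; have hX := @khaus_hausdorff X.
have cx : closed [set x].
  by apply: accessible_closed_set1; exact: hausdorff_accessible.
have nX : normal_space X := compact_normal hX (@khaus_compact X).
have /(@uniform_separatorP _ R)[f [cf f01 fB fx]] :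
    uniform_separator B [set x].
  apply: (@normal_separatorP R X).1 => //.
  by apply/seteqP; split=> // y [By yx]; apply: nBx; rewrite -yx.
have f01' y : 0 <= f y <= 1.
  by have := f01 (f y); rewrite /= in_itv /=; apply; exists y.
have f0 y : 0 <= f y by have /andP[] := f01' y.
exists (CPos cf f0); split => /=.
- by apply: fx; exists x.
- by move=> y By; apply: fB; exists y.
- by move=> y; have /andP[] := f01' y.
Qed.

Lemma cpos_approx h x (a : R) : (a%:E < h x)%E ->
  exists2 g, cpos_below h g & a < g x.
Proof.
move=> ah; have [a0|a0] := ltP a 0.
  exists (cpos_cst X (lexx 0)) => // y /=; exact: lsc_ge0.
have [b /andP[ab bh]] : exists b : R, (a < b) && (b%:E < h x)%E.
  move: ah; case: (h x) => [v||]//; last by move=> _; exists (a + 1); rewrite ltry; lra.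
  by rewrite lte_fin => av; exists ((a + v) / 2); rewrite lte_fin; lra.
have b0 : 0 <= b by lra.
pose B := ~` [set y | (b%:E < h y)%E].
have cB : closed B.
  apply: open_closedC; apply: (lower_semicontinuousP _).1.
  exact: (@lsc_lower_semicontinuous _ _ h).
have [|f [fx fB f1]] := khaus_urysohn (x := x) cB; first by move=> /(_ bh).
exists (cpos_scale b0 f) => [y|] /=; last by rewrite fx mulr1.
have [By|nBy] := pselect (B y).
  by rewrite (fB _ By) mulr0; exact: lsc_ge0.
apply: (@le_trans _ _ b%:E); last by apply: ltW; apply: contrapT => nb; apply: nBy.
by rewrite lee_fin -[leRHS]mulr1 ler_wpM2l.
Qed.

Lemma cpos_dini (D : set (lsc R X)) g : lsc_directed D ->
  (forall x, exists2 k, D k & ((g x)%:E < k x)%E) ->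
  exists2 k, D k & forall x, ((g x)%:E < k x)%E.
Proof.
move=> [D0 DD] H.
have := @compact_ideal _ setT [set S : set X | exists2 k, D k &
  forall x, S x -> ((g x)%:E < k x)%E] (@khaus_compact X).
case=> /=.
- by have [k Dk] := D0; exists k.
- by move=> A B AB [k Dk kB]; exists k => // x /AB; exact: kB.
- move=> A B [k Dk kA] [l Dl lB]; have [m [Dm km lm]] := DD _ _ Dk Dl.
  exists m => // x [Ax|Bx].
    by apply: lt_le_trans (km x); exact: kA.
  by apply: lt_le_trans (lm x); exact: lB.
- move=> x _; have [k Dk gk] := H x.
  have [b /andP[gb bk]] : exists b : R, (g x < b) && (b%:E < k x)%E.
    move: gk; case: (k x) => [v||]//; last by move=> _; exists (g x + 1); rewrite ltry; lra.
    by rewrite lte_fin => av; exists ((g x + v) / 2); rewrite lte_fin; lra.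
  have [V xV VH] := lsc_lower_semicontinuous bk.
  exists (V `&` [set y | g y < b]).
    apply: filterI => //; apply: (@cpos_cont _ _ g x [set z | z < b]).
    by apply: open_nbhs_nbhs; split => //; exact: open_lt.
  exists k => // y [/VH bky gyb]; apply: lt_trans bky.
  by rewrite lte_fin.
- by move=> k Dk Hk; exists k => // x; exact: Hk.
Qed.

Lemma cpos_bounded g : exists2 M : R, 0 <= M & forall x, g x <= M.
Proof.
have := @compact_ideal _ setT [set S : set X | exists2 M : R, 0 <= M &
  forall x, S x -> g x <= M] (@khaus_compact X).
case=> /=.
- by exists 0.
- by move=> A B AB [M M0 MB]; exists M => // x /AB; exact: MB.
- move=> A B [M M0 MA] [N N0 NB]; exists (M + N); first exact: addr_ge0.
  by move=> x [/MA|/NB] gx; lra.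
- move=> x _; exists [set y | g y < g x + 1].
    apply: (@cpos_cont _ _ g x [set z | z < g x + 1]).
    by apply: open_nbhs_nbhs; split => /=; [exact: open_lt|lra].
  by exists (g x + 1) => [|y /ltW//]; have := cpos_ge0 g x; lra.
- by move=> M M0 HM; exists M => // x; exact: HM.
Qed.

Lemma cpos_below_directed h : lsc_directed (@cpos_lsc R X @` cpos_below h).
Proof.
split.
  exists (cpos_lsc (cpos_cst X (lexx 0))), (cpos_cst X (lexx 0)) => // x.
  exact: lsc_ge0.
move=> _ _ [g1 b1 <-] [g2 b2 <-]; exists (cpos_lsc (cpos_max g1 g2)); split.
- by exists (cpos_max g1 g2) => //; exact: cpos_below_max.
- by move=> x; rewrite /= lee_fin le_max lexx.
- by move=> x; rewrite /= lee_fin le_max lexx orbT.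
Qed.

Lemma cpos_below_lub h : lsc_lub (@cpos_lsc R X @` cpos_below h) h.
Proof.
split=> [_ [g gh <-]|k kub x]; first exact: gh.
rewrite leNgt; apply/negP => kh.
have [a /andP[ka ah]] : exists a : R, (k x <= a%:E)%E && (a%:E < h x)%E.
  move: kh (lsc_ge0 k x); case: (k x) => [v vh _||//].
    by exists v; rewrite lexx.
  by rewrite ltNge leey.
have [g gh ag] := cpos_approx ah.
have /kub /(_ x) /= gk : (@cpos_lsc R X @` cpos_below h) (cpos_lsc g).
  by exists g.
have := le_trans gk ka.
by rewrite lee_fin leNgt ag.
Qed.
End approximation.

Section extension.
Variables (R : realType) (X : khaus).
Implicit Types (g : cpos R X) (h : lsc R X) (l : cpos R X -> R).

Definition cpos_ext l h : \bar R := ereal_sup [set (l g)%:E | g in cpos_below h].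

Record cpos_state l : Prop := CposState {
  state_ge0 : forall g, 0 <= l g;
  state_mono : forall g1 g2, (forall x, g1 x <= g2 x) -> l g1 <= l g2;
  state_scale : forall (a : R) (a0 : 0 <= a) g, l (cpos_scale a0 g) = a * l g;
  state_shift : forall (c : R) (c0 : 0 <= c) g,
    l (cpos_add (cpos_cst X c0) g) = c + l g }.

Lemma state_sub l g (c : R) (c0 : 0 <= c) : cpos_state l ->
  l g <= c + l (cpos_sub g c).
Proof.
move=> Hl; rewrite -(state_shift Hl c0); apply: state_mono => // x /=.
by rewrite -lerBlDl le_max lexx.
Qed.

Lemma cpos_ext_ub l h g : cpos_below h g -> ((l g)%:E <= cpos_ext l h)%E.
Proof. by move=> gh; apply: ereal_sup_ubound; exists g. Qed.

Lemma cpos_ext_ge0 l h : cpos_state l -> (0 <= cpos_ext l h)%E.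
Proof.
move=> Hl; apply: (@le_trans _ _ (l (cpos_cst X (lexx 0)))%:E).
  by rewrite lee_fin; exact: state_ge0.
by apply: cpos_ext_ub => x; exact: lsc_ge0.
Qed.

Lemma cpos_ext_mono l h k : lsc_le h k -> (cpos_ext l h <= cpos_ext l k)%E.
Proof.
move=> hk; apply: ge_ereal_sup => _ [g gh <-]; apply: cpos_ext_ub => x.
exact: le_trans (gh x) (hk x).
Qed.

Lemma cpos_dini_lub (D : set (lsc R X)) h g (e : R) : lsc_directed D ->
  lsc_lub D h -> cpos_below h g -> 0 < e ->
  exists2 k, D k & forall x, ((g x)%:E <= e%:E + k x)%E.
Proof.
move=> dD lD gh e0; have [D0 DD] := dD.
pose tr k := lsc_add (cpos_lsc (cpos_cst X (ltW e0))) k.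
have dtD : lsc_directed (tr @` D).
  split; first by have [k Dk] := D0; exists (tr k), k.
  move=> _ _ [k Dk <-] [m Dm <-]; have [n [Dn kn mn]] := DD _ _ Dk Dm.
  exists (tr n); split; first by exists n.
  - by move=> x /=; exact: leeD2l (kn x).
  - by move=> x /=; exact: leeD2l (mn x).
have [x|_ [k Dk <-] gk] := cpos_dini (g := g) dtD; last first.
  by exists k => // x; apply: ltW; exact: gk.
have := gh x; rewrite ((lsc_lubP _ D0).1 lD x) /= => gsup.
have : ((g x - e)%:E < ereal_sup [set (k : lsc R X) x | k in D])%E.
  by apply: lt_le_trans gsup; rewrite lte_fin; lra.
move=> /ereal_sup_gt[_ [k Dk <-] ek].
by exists (tr k); [exists k|rewrite /= addeC -lteBlDr].
Qed.

Lemma cpos_ext_scott l : cpos_state l -> scott_continuous (cpos_ext l).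
Proof.
move=> Hl; split=> [|D h dD lD]; first exact: cpos_ext_mono.
apply/eqP; rewrite eq_le; apply/andP; split; last first.
  apply: ge_ereal_sup => _ [k Dk <-]; apply: cpos_ext_mono; exact: lD.1.
apply: ge_ereal_sup => _ [g gh <-]; apply/lee_addgt0Pr => e e0.
have [k Dk gk] := cpos_dini_lub dD lD gh e0.
apply: (@le_trans _ _ (e + l (cpos_sub g e))%:E).
  by rewrite lee_fin; apply: state_sub => //; exact: ltW.
rewrite EFinD addeC leeD2r//; apply: (@le_trans _ _ (cpos_ext l k)).
  apply: cpos_ext_ub => x /=; rewrite EFin_max ge_max lsc_ge0 andbT.
  by rewrite EFinB leeBlDl.
by apply: ereal_sup_ubound; exists k.
Qed.

Lemma cpos_ext_scale l (a : R) (a0 : 0 <= a) h : cpos_state l ->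
  cpos_ext l (lsc_scale a0 h) = (a%:E * cpos_ext l h)%E.
Proof.
move=> Hl; have l0 : l (cpos_cst X (lexx 0)) = 0.
  apply/eqP; rewrite eq_le state_ge0// andbT.
  apply: (@le_trans _ _ (l (cpos_scale (lexx 0) (cpos_cst X (lexx 0))))).
    by apply: state_mono => // x /=; rewrite mul0r.
  by rewrite state_scale// mul0r.
apply/eqP; rewrite eq_le; apply/andP; split.
  apply: ge_ereal_sup => _ [g gh <-].
  have [a_gt0|a_le0] := ltP 0 a; last first.
    have ae : a = 0 by apply/eqP; rewrite eq_le a_le0.
    rewrite ae mul0e lee_fin -l0; apply: state_mono => // x /=.
    by have := gh x; rewrite /= ae mul0e lee_fin.
  have ai0 : 0 <= a^-1 by rewrite invr_ge0.
  rewrite muleC -lee_pdivrMr// -EFinM mulrC -(state_scale Hl ai0).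
  apply: cpos_ext_ub => x /=.
  by rewrite mulrC EFinM lee_pdivrMr// muleC; exact: gh.
rewrite -ereal_supZl//; last first.
  apply/set0P; exists (l (cpos_cst X (lexx 0)))%:E, (cpos_cst X (lexx 0)) => // x.
  exact: lsc_ge0.
apply: ge_ereal_sup => _ [_ [g gh <-] <-].
rewrite -EFinM -(state_scale Hl a0); apply: cpos_ext_ub => x /=.
by rewrite EFinM lee_wpmul2l//; exact: gh.
Qed.

Lemma cpos_ext_prevision l : cpos_state l -> is_prevision (cpos_ext l).
Proof.
move=> Hl; split.
- by move=> h; exact: cpos_ext_ge0.
- exact: cpos_ext_scott.
- by move=> a a0 h; exact: cpos_ext_scale.
Qed.

Lemma cpos_ext_normalized l : cpos_state l -> normalized (cpos_ext l).
Proof.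
move=> Hl h; apply/eqP; rewrite eq_le; apply/andP; split.
  apply: ge_ereal_sup => _ [g gh <-].
  apply: (@le_trans _ _ (1 + l (cpos_sub g 1))%:E).
    by rewrite lee_fin; exact: state_sub.
  rewrite EFinD leeD2l//; apply: cpos_ext_ub => x /=.
  by rewrite EFin_max ge_max lsc_ge0 andbT EFinB leeBlDl//; exact: gh.
rewrite addeC -leeBrDr//; apply: ge_ereal_sup => _ [g gh <-].
rewrite leeBrDr// -EFinD addrC -(state_shift Hl ler01).
by apply: cpos_ext_ub => x /=; rewrite EFinD leeD2l//; exact: gh.
Qed.

Lemma cpos_ext_add l1 l2 l3 h k : cpos_state l1 ->
  (forall g1 g2, l1 g1 + l2 g2 <= l3 (cpos_add g1 g2)) ->
  (cpos_ext l1 h + cpos_ext l2 k <= cpos_ext l3 (lsc_add h k))%E.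
Proof.
move=> Hl1 H; have E1 := cpos_ext_ge0 h Hl1.
have H' g2 : cpos_below k g2 ->
    (cpos_ext l1 h + (l2 g2)%:E <= cpos_ext l3 (lsc_add h k))%E.
  move=> g2k; rewrite -leeBrDr//; apply: ge_ereal_sup => _ [g1 g1h <-].
  rewrite leeBrDr//; apply: (@le_trans _ _ (l3 (cpos_add g1 g2))%:E).
    by rewrite -EFinD lee_fin.
  by apply: cpos_ext_ub => x /=; rewrite EFinD leeD//; [exact: g1h|exact: g2k].
move: E1 H'; case: (cpos_ext l1 h) => [v||]// v0 H'.
- rewrite -leeBrDl//; apply: ge_ereal_sup => _ [g2 g2k <-].
  by rewrite leeBrDl//; exact: H'.
- have /H' : cpos_below k (cpos_cst X (lexx 0)) by move=> x; exact: lsc_ge0.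
  by rewrite addye// leye_eq => /eqP ->; exact: leey.
Qed.

Lemma cpos_split g h k (e : R) : cpos_below (lsc_add h k) g -> 0 < e ->
  exists g1 g2, [/\ cpos_below h g1, cpos_below k g2 &
    forall x, g x <= e + (g1 x + g2 x)].
Proof.
move=> ghk e0.
pose D := [set m | exists g1 g2, [/\ cpos_below h g1, cpos_below k g2 &
  m = cpos_lsc (cpos_add g1 g2)]].
have z h' : cpos_below h' (cpos_cst X (lexx 0)) by move=> x; exact: lsc_ge0.
have D0 : D !=set0.
  exists (cpos_lsc (cpos_add (cpos_cst X (lexx 0)) (cpos_cst X (lexx 0)))).
  by exists (cpos_cst X (lexx 0)), (cpos_cst X (lexx 0)).
have dD : lsc_directed D.
  split=> // _ _ [g1 [g2 [g1h g2k ->]]] [f1 [f2 [f1h f2k ->]]].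
  exists (cpos_lsc (cpos_add (cpos_max g1 f1) (cpos_max g2 f2))); split.
  - exists (cpos_max g1 f1), (cpos_max g2 f2).
    by split; [exact: cpos_below_max|exact: cpos_below_max|].
  - by move=> x; rewrite /= lee_fin lerD// le_max lexx.
  - by move=> x; rewrite /= lee_fin lerD// le_max lexx orbT.
have lD : lsc_lub D (lsc_add h k).
  split=> [_ [g1 [g2 [g1h g2k ->]]] x|m mub x].
    by rewrite /= EFinD leeD//; [exact: g1h|exact: g2k].
  rewrite leNgt; apply/negP => mx.
  have [a /andP[ma ahk]] : exists a : R, (m x <= a%:E)%E && (a%:E < h x + k x)%E.
    move: mx (lsc_ge0 m x) => /=; case: (m x) => [v vh _||//].
      by exists v; rewrite lexx.
    by rewrite ltNge leey.
  have [b [c [bh ck abc]]] := lte_add_split (lsc_ge0 h x) (lsc_ge0 k x) ahk.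
  have [g1 g1h bg1] := cpos_approx bh; have [g2 g2k cg2] := cpos_approx ck.
  have /mub /(_ x) /= gm : D (cpos_lsc (cpos_add g1 g2)) by exists g1, g2.
  have := le_trans gm ma; rewrite lee_fin; lra.
have [_ [g1 [g2 [g1h g2k ->]]] H] := cpos_dini_lub dD lD ghk e0.
by exists g1, g2; split => // x; have := H x; rewrite /= -EFinD lee_fin.
Qed.

Lemma cpos_add_ext l1 l2 l3 h k : cpos_state l3 ->
  (forall g1 g2, l3 (cpos_add g1 g2) <= l1 g1 + l2 g2) ->
  (cpos_ext l3 (lsc_add h k) <= cpos_ext l1 h + cpos_ext l2 k)%E.
Proof.
move=> Hl3 H; apply: ge_ereal_sup => _ [g ghk <-]; apply/lee_addgt0Pr => e e0.
have [g1 [g2 [g1h g2k gx]]] := cpos_split ghk e0.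
apply: (@le_trans _ _ (e + (l1 g1 + l2 g2))%:E).
  rewrite lee_fin; apply: le_trans (lerD (lexx e) (H g1 g2)).
  by rewrite -(state_shift Hl3 (ltW e0)); apply: state_mono.
by rewrite EFinD addeC leeD2r// EFinD leeD//; exact: cpos_ext_ub.
Qed.
End extension.

Section ultra_limit.
Variables (R : realType) (X : khaus) (P : topologicalType) (W : set_system P).
Hypothesis UW : UltraFilter W.
Variable Phi : P -> lsc R X -> \bar R.
Hypothesis PhiP : forall p, is_prevision (Phi p).
Hypothesis PhiN : forall p, normalized (Phi p).
Implicit Types (g : cpos R X) (h : lsc R X).

Lemma prevision_cst (F : lsc R X -> \bar R) (c : R) (c0 : 0 <= c) h :
  is_prevision F -> normalized F ->
  (F (lsc_add (cpos_lsc (cpos_cst X c0)) h) = c%:E + F h)%E.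
Proof.
move=> PF NF; have [c_gt0|c_le0] := ltP 0 c; last first.
  have ce : c = 0 by apply/eqP; rewrite eq_le c_le0.
  by subst c; rewrite add0e; congr F; apply: lsc_eq => x /=; rewrite add0e.
have ci0 : 0 <= c^-1 by rewrite invr_ge0.
have -> : lsc_add (cpos_lsc (cpos_cst X c0)) h =
    lsc_scale c0 (lsc_add lsc_one (lsc_scale ci0 h)).
  apply: lsc_eq => x /=; rewrite ge0_muleDr ?lee01 ?mule_ge0 ?lee_fin ?lsc_ge0//.
  by rewrite mule1 muleA -EFinM divff ?mul1e// gt_eqF.
rewrite prevision_scale// NF prevision_scale// ge0_muleDr ?lee01 ?mule_ge0 ?lee_fin ?prevision_ge0//.
by rewrite mule1 muleA -EFinM divff ?mul1e// gt_eqF.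
Qed.

Lemma prevision_bounded (F : lsc R X -> \bar R) (M : R) (M0 : 0 <= M) g :
  is_prevision F -> normalized F -> (forall x, g x <= M) ->
  (F (cpos_lsc g) <= M%:E)%E.
Proof.
move=> PF NF gM.
have F0 : F (lsc_scale (lexx 0) lsc_one) = 0%E by rewrite prevision_scale// mul0e.
rewrite -[leRHS]adde0 -F0 -(prevision_cst M0 _ PF NF).
apply: (prevision_scott PF).1 => x /=.
by rewrite mul0e adde0 lee_fin.
Qed.

Lemma prevision_fin (F : lsc R X -> \bar R) g :
  is_prevision F -> normalized F -> (F (cpos_lsc g)) \is a fin_num.
Proof.
move=> PF NF; have [M M0 gM] := cpos_bounded g.
rewrite ge0_fin_numE; last exact: prevision_ge0.
by apply: le_lt_trans (prevision_bounded M0 PF NF gM) _; exact: ltry.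
Qed.

Definition ulim g : R := lim (fine (Phi p (cpos_lsc g)) @[p --> W]).

Lemma ulim_cvg g : fine (Phi p (cpos_lsc g)) @[p --> W] --> ulim g.
Proof.
have PW := @ultra_proper _ _ UW.
have [M M0 gM] := cpos_bounded g.
have := @segment_compact R 0 M; set f := fun p => fine (Phi p (cpos_lsc g)).
move=> /(_ (f @ W) _) [|l [_ cl]].
  apply: (@filterE _ W) => p; rewrite /= /f in_itv /= fine_ge0 ?prevision_ge0//=.
  by rewrite -lee_fin fineK ?prevision_fin// prevision_bounded.
apply/cvg_ex; exists l => A Al; rewrite /nbhs /=.
have [//|nA] := in_ultra_setVsetC (f @^-1` A) UW.
have [|y []//] := cl (~` A) A _ Al; exact: nA.
Qed.

Lemma ulim_gt g (r : R) : r < ulim g ->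
  W [set p | (r%:E < Phi p (cpos_lsc g))%E].
Proof.
move=> rg; have : W [set p | r < fine (Phi p (cpos_lsc g))].
  by apply: (@ulim_cvg g [set y | r < y]); apply: open_nbhs_nbhs; split => //; exact: open_gt.
by apply: filterS => p /=; rewrite -lte_fin fineK//; exact: prevision_fin.
Qed.

Lemma ulim_state : cpos_state ulim.
Proof.
have PW := @ultra_proper _ _ UW.
have fE p g := prevision_fin g (PhiP p) (PhiN p).
split.
- move=> g; apply: (ler_cvg_to (a := W) (cvg_cst 0) (@ulim_cvg g)).
  by apply: filterE => p; rewrite fine_ge0// prevision_ge0.
- move=> g1 g2 g12; apply: (ler_cvg_to (a := W) (@ulim_cvg g1) (@ulim_cvg g2)).
  apply: filterE => p; rewrite -lee_fin !fineK//.
  by apply: (prevision_scott (PhiP p)).1 => x; rewrite lee_fin.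
- move=> a a0 g.
  have : fine (Phi p (cpos_lsc (cpos_scale a0 g))) @[p --> W] --> a * ulim g.
    rewrite (_ : (fun p => _) = (fun p => a * fine (Phi p (cpos_lsc g)))).
      by apply: cvgM; [exact: cvg_cst|exact: ulim_cvg].
    apply/funext => p; rewrite (_ : cpos_lsc _ = lsc_scale a0 (cpos_lsc g)).
      by rewrite prevision_scale// fineM.
    exact: lsc_eq.
  by move=> /(cvg_lim (@Rhausdorff R)).
- move=> c c0 g.
  have : fine (Phi p (cpos_lsc (cpos_add (cpos_cst X c0) g))) @[p --> W] --> c + ulim g.
    rewrite (_ : (fun p => _) = (fun p => c + fine (Phi p (cpos_lsc g)))).
      by apply: cvgD; [exact: cvg_cst|exact: ulim_cvg].
    apply/funext => p; rewrite (_ : cpos_lsc _ = lsc_add (cpos_lsc (cpos_cst X c0)) (cpos_lsc g)).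
      by rewrite prevision_cst// fineD.
    exact: lsc_eq.
  by move=> /(cvg_lim (@Rhausdorff R)).
Qed.
End ultra_limit.

Section prevision_spaces.
Variables (R : realType) (X : khaus).
Implicit Types (g : cpos R X) (h : lsc R X).

Lemma prevision_approx (F : lsc R X -> \bar R) h (r : R) : is_prevision F ->
  (r%:E < F h)%E -> exists2 g, cpos_below h g & (r%:E < F (cpos_lsc g))%E.
Proof.
move=> PF; rewrite ((prevision_scott PF).2 _ _ (cpos_below_directed h)
  (cpos_below_lub h)).
by move=> /ereal_sup_gt[_ [_ [g gh <-] <-] rg]; exists g.
Qed.

Lemma cpos_ext_gt (l : cpos R X -> R) h (r : R) :
  (r%:E < cpos_ext l h)%E -> exists2 g, cpos_below h g & r < l g.
Proof. by move=> /ereal_sup_gt[_ [g gh <-]]; exists g. Qed.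

Lemma fork_space_compact : compact [set: fork R X].
Proof.
rewrite compact_ultra => W UW _.
have PW := @ultra_proper _ _ UW.
have Plo F := (@fork_loP R X F).1; have Pup F := (@fork_upP R X F).1.
have Nlo F := @fork_lo_normalized R X F; have Nup F := @fork_up_normalized R X F.
have Slo := ulim_state UW Plo Nlo; have Sup := ulim_state UW Pup Nup.
have Clo g := @ulim_cvg _ _ _ _ UW _ Plo Nlo g.
have Cup g := @ulim_cvg _ _ _ _ UW _ Pup Nup g.
have addE g1 g2 : cpos_lsc (cpos_add g1 g2) = lsc_add (cpos_lsc g1) (cpos_lsc g2).
  exact: lsc_eq.
pose lo := ulim W (@fork_lo R X); pose up := ulim W (@fork_up R X).
have lo_fin F g : fork_lo F (cpos_lsc g) \is a fin_num by exact: prevision_fin.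
have up_fin F g : fork_up F (cpos_lsc g) \is a fin_num by exact: prevision_fin.
have lolo g1 g2 : lo g1 + lo g2 <= lo (cpos_add g1 g2).
  apply: (ler_cvg_to (a := W) (cvgD (Clo g1) (Clo g2)) (Clo _)).
  apply: filterE => F; rewrite -lee_fin EFinD !fineK//.
  by rewrite addE; exact: (fork_loP F).2.
have upup g1 g2 : up (cpos_add g1 g2) <= up g1 + up g2.
  apply: (ler_cvg_to (a := W) (Cup _) (cvgD (Cup g1) (Cup g2))).
  apply: filterE => F; rewrite -lee_fin EFinD !fineK//.
  by rewrite addE; exact: (fork_upP F).2.
have loloup g1 g2 : lo (cpos_add g1 g2) <= lo g1 + up g2.
  apply: (ler_cvg_to (a := W) (Clo _) (cvgD (Clo g1) (Cup g2))).
  apply: filterE => F; rewrite -lee_fin EFinD !fineK//.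
  by rewrite addE; exact: fork_lo_add.
have loupup g1 g2 : lo g1 + up g2 <= up (cpos_add g1 g2).
  apply: (ler_cvg_to (a := W) (cvgD (Clo g1) (Cup g2)) (Cup _)).
  apply: filterE => F; rewrite -lee_fin EFinD !fineK//.
  by rewrite addE; exact: fork_add_up.
pose F0 : fork R X := @Fork R X (cpos_ext lo) (cpos_ext up)
  (conj (cpos_ext_prevision Slo) (fun h k => cpos_ext_add h k Slo lolo))
  (conj (cpos_ext_prevision Sup) (fun h k => cpos_add_ext h k Sup upup))
  (cpos_ext_normalized Slo) (cpos_ext_normalized Sup)
  (fun h k => cpos_add_ext h k Slo loloup)
  (fun h k => cpos_ext_add h k Slo loupup).
exists F0; split => //.
apply: (@subbase_cvg _ (@fork_subbase R X)) => A [h [r [->|->]]] /=.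
- move=> /cpos_ext_gt[g gh /(ulim_gt UW Plo Nlo)]; apply: filterS => F /= rF.
  by apply: lt_le_trans rF _; exact: (prevision_scott (Plo F)).1.
- move=> /cpos_ext_gt[g gh /(ulim_gt UW Pup Nup)]; apply: filterS => F /= rF.
  by apply: lt_le_trans rF _; exact: (prevision_scott (Pup F)).1.
Qed.

Lemma linprev_space_compact : compact [set: linprev R X].
Proof.
rewrite compact_ultra => W UW _.
have PW := @ultra_proper _ _ UW.
have P F := (@linprevP R X F).1; have N F := @linprev_normalized R X F.
have S := ulim_state UW P N.
have C g := @ulim_cvg _ _ _ _ UW _ P N g.
have addE g1 g2 : cpos_lsc (cpos_add g1 g2) = lsc_add (cpos_lsc g1) (cpos_lsc g2).
  exact: lsc_eq.
pose l := ulim W (@linprev_fun R X).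
have l_fin (F : linprev R X) g : F (cpos_lsc g) \is a fin_num.
  exact: prevision_fin.
have lD g1 g2 : l (cpos_add g1 g2) = l g1 + l g2.
  apply/eqP; rewrite eq_le; apply/andP; split.
    apply: (ler_cvg_to (a := W) (C _) (cvgD (C g1) (C g2))).
    apply: filterE => F; rewrite -lee_fin EFinD !fineK//.
    by rewrite addE (linprevP F).2.
  apply: (ler_cvg_to (a := W) (cvgD (C g1) (C g2)) (C _)).
  apply: filterE => F; rewrite -lee_fin EFinD !fineK//.
  by rewrite addE (linprevP F).2.
have lext h k : cpos_ext l (lsc_add h k) = (cpos_ext l h + cpos_ext l k)%E.
  apply/eqP; rewrite eq_le; apply/andP; split.
    by apply: cpos_add_ext => // g1 g2; rewrite lD.
  by apply: cpos_ext_add => // g1 g2; rewrite lD.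
pose F0 : linprev R X := @LinPrev R X (cpos_ext l)
  (conj (cpos_ext_prevision S) lext) (cpos_ext_normalized S).
exists F0; split => //.
apply: (@subbase_cvg _ (@linprev_subbase R X)) => A [h [r ->]] /=.
move=> /cpos_ext_gt[g gh /(ulim_gt UW P N)]; apply: filterS => F /= rF.
by apply: lt_le_trans rF _; exact: (prevision_scott (P F)).1.
Qed.

Lemma fork_compl (F : fork R X) g (M : R) (M0 : 0 <= M) :
  (forall x, g x <= M) ->
  (fork_lo F (cpos_lsc g) + fork_up F (cpos_lsc (cpos_compl g M)) = M%:E)%E.
Proof.
move=> gM.
have E : lsc_add (cpos_lsc g) (cpos_lsc (cpos_compl g M)) =
    lsc_add (cpos_lsc (cpos_cst X M0)) (lsc_scale (lexx 0) lsc_one).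
  apply: lsc_eq => x /=; rewrite mul0e adde0 -EFinD; congr EFin.
  have /max_idPl -> : 0 <= M - g x by rewrite subr_ge0.
  by rewrite addrC subrK.
apply/eqP; rewrite eq_le; apply/andP; split.
  apply: le_trans (fork_add_up _ _ _) _.
  rewrite E prevision_cst; last exact: fork_up_normalized.
    by rewrite (prevision_scale (fork_upP F).1) mul0e adde0.
  exact: (fork_upP F).1.
apply: le_trans (fork_lo_add _ _ _).
rewrite E prevision_cst; last exact: fork_lo_normalized.
  by rewrite (prevision_scale (fork_loP F).1) mul0e adde0.
exact: (fork_loP F).1.
Qed.

Lemma fork_compl' (F : fork R X) g (M : R) (M0 : 0 <= M) :
  (forall x, g x <= M) ->
  (fork_lo F (cpos_lsc (cpos_compl g M)) + fork_up F (cpos_lsc g) = M%:E)%E.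
Proof.
move=> gM; have cM x : cpos_compl g M x <= M.
  by rewrite /= ge_max M0 andbT lerBlDr lerDl cpos_ge0.
rewrite -(fork_compl F M0 cM); congr (_ + fork_up F _)%E.
apply: lsc_eq => x /=; congr EFin.
have /max_idPl -> : 0 <= M - g x by rewrite subr_ge0.
by rewrite subKr; apply/esym/max_idPl; exact: cpos_ge0.
Qed.

Lemma fork_separate (F G : fork R X) : F <> G ->
  exists A B : set (fork R X), [/\ open A, open B, A F, B G & A `&` B = set0].
Proof.
move=> FG.
(* a F (g) + c F (M - g) = M turns the condition a F (g) < t, which is not
   subbasic, into the subbasic one M - t < c F (M - g). *)
have W (a c : fork R X -> lsc R X -> \bar R) :
    (forall F, is_prevision (a F)) -> (forall F, normalized (a F)) ->
    (forall F, is_prevision (c F)) -> (forall F, normalized (c F)) ->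
    (forall h (r : R), open [set F | r%:E < a F h]%E) ->
    (forall h (r : R), open [set F | r%:E < c F h]%E) ->
    (forall F g (M : R), 0 <= M -> (forall x, g x <= M) ->
      (a F (cpos_lsc g) + c F (cpos_lsc (cpos_compl g M)) = M%:E)%E) ->
    forall (F G : fork R X) h, (a F h < a G h)%E ->
    exists A B : set (fork R X), [/\ open A, open B, A F, B G & A `&` B = set0].
  move=> Pa Na Pc Nc oa oc ac {FG} {}F {}G h FGh.
  have [r /andP[Fr rG]] : exists r : R, (a F h <= r%:E)%E && (r%:E < a G h)%E.
    move: FGh (prevision_ge0 (Pa F) h); case: (a F h) => [v vG _||//].
      by exists v; rewrite lexx.
    by rewrite ltNge leey.
  have [g gh rg] := prevision_approx (Pa G) rG.
  have [M M0 gM] := cpos_bounded g.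
  have Fg : (a F (cpos_lsc g) <= r%:E)%E.
    by apply: le_trans Fr; exact: (prevision_scott (Pa F)).1.
  have afin H : a H (cpos_lsc g) \is a fin_num by exact: prevision_fin.
  have cfin H : c H (cpos_lsc (cpos_compl g M)) \is a fin_num.
    exact: prevision_fin.
  have E H : fine (a H (cpos_lsc g)) + fine (c H (cpos_lsc (cpos_compl g M))) = M.
    by apply: EFin_inj; rewrite EFinD !fineK//; exact: ac.
  pose t := (r + fine (a G (cpos_lsc g))) / 2.
  have rG' : r < fine (a G (cpos_lsc g)) by rewrite -lte_fin fineK.
  have Fg' : fine (a F (cpos_lsc g)) <= r by rewrite -lee_fin fineK.
  exists [set H | (M - t)%:E < c H (cpos_lsc (cpos_compl g M))]%E.
  exists [set H | t%:E < a H (cpos_lsc g)]%E; split => //=.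
  - by rewrite -(fineK (cfin F)) lte_fin; have := E F; rewrite /t; lra.
  - by rewrite -(fineK (afin G)) lte_fin /t; lra.
  - apply/seteqP; split => // H [/=].
    rewrite -(fineK (cfin H)) -(fineK (afin H)) !lte_fin.
    by have := E H; lra.
have Plo F := (@fork_loP R X F).1; have Pup F := (@fork_upP R X F).1.
have Nlo F := @fork_lo_normalized R X F; have Nup F := @fork_up_normalized R X F.
have Wlo := W _ _ Plo Nlo Pup Nup (@fork_lo_open R X) (@fork_up_open R X)
  (fun F g M M0 gM => fork_compl F M0 gM).
have Wup := W _ _ Pup Nup Plo Nlo (@fork_up_open R X) (@fork_lo_open R X)
  (fun F g M M0 gM => etrans (addeC _ _) (fork_compl' F M0 gM)).
have swap : (exists A B : set (fork R X),
    [/\ open A, open B, A G, B F & A `&` B = set0]) ->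
    exists A B : set (fork R X), [/\ open A, open B, A F, B G & A `&` B = set0].
  by move=> [A [B [oA oB AG BF AB]]]; exists B, A; split => //; rewrite setIC.
have [[h lo_ne]|lo_eq] := pselect (exists h, fork_lo F h <> fork_lo G h).
  have [lt|gt|//] := ltgtP (fork_lo F h) (fork_lo G h); first exact: Wlo lt.
  by apply: swap; exact: Wlo gt.
have [[h up_ne]|up_eq] := pselect (exists h, fork_up F h <> fork_up G h).
  have [lt|gt|//] := ltgtP (fork_up F h) (fork_up G h); first exact: Wup lt.
  by apply: swap; exact: Wup gt.
exfalso; apply: FG; apply: fork_eq => h; apply: contrapT => ne.
- by apply: lo_eq; exists h.
- by apply: up_eq; exists h.
Qed.

Lemma fork_space_hausdorff : hausdorff_space (fork R X).
Proof.
rewrite open_hausdorff => F G /eqP /fork_separate[A [B [oA oB AF BG AB]]].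
by exists (A, B); rewrite /= ?inE//; split => //; apply/eqP.
Qed.

Definition linprev_fork (F : linprev R X) : fork R X.
Proof.
refine (@Fork R X F F (conj (linprevP F).1 _) (conj (linprevP F).1 _)
  (@linprev_normalized R X F) (@linprev_normalized R X F) _ _) => h k;
by rewrite (linprevP F).2.
Defined.

Lemma linprev_space_hausdorff : hausdorff_space (linprev R X).
Proof.
rewrite open_hausdorff => F G /eqP FG.
have cf : continuous linprev_fork.
  by apply: fork_continuous => h r; exact: linprev_open.
have : linprev_fork F <> linprev_fork G.
  move=> e; apply: FG; apply: linprev_eq => h.
  by have /(congr1 (fun H => fork_lo H h)) := e.
move=> /fork_separate[A [B [oA oB AF BG AB]]].
exists (linprev_fork @^-1` A, linprev_fork @^-1` B); rewrite /= ?inE//; split.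
- by apply: open_comp => // H _; exact: cf.
- by apply: open_comp => // H _; exact: cf.
- by apply/eqP; rewrite -preimage_setI AB preimage_set0.
Qed.
End prevision_spaces.

Definition linprev_khaus (R : realType) (X : khaus) : khaus :=
  KHausSpace (@linprev_space_compact R X) (@linprev_space_hausdorff R X).

Definition fork_khaus (R : realType) (X : khaus) : khaus :=
  KHausSpace (@fork_space_compact R X) (@fork_space_hausdorff R X).

Section prevision_monads.
Variable R : realType.

Definition PP1_functor : functor KHaus KHaus.
Proof.
refine (@Functor KHaus KHaus (linprev_khaus R)
  (fun X Y f => cmap (@linprev_map_continuous R X Y f)) _ _).
- move=> X; apply/continuousEP => F; apply: linprev_eq => h /=.
  by congr (linprev_fun F _); apply: lsc_eq.
- move=> X Y Z g f; apply/continuousEP => F; apply: linprev_eq => h /=.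
  by congr (linprev_fun F _); apply: lsc_eq.
Defined.

Definition PP1_eta : nat_trans (functor_id KHaus) PP1_functor.
Proof.
refine (@NatTrans KHaus KHaus (functor_id KHaus) PP1_functor
  (fun X => cmap (@linprev_unit_continuous R X)) _).
by move=> X Y f; apply/continuousEP => x; apply: linprev_eq.
Defined.

Definition PP1_mu : nat_trans (functor_comp PP1_functor PP1_functor) PP1_functor.
Proof.
refine (@NatTrans KHaus KHaus (functor_comp PP1_functor PP1_functor) PP1_functor
  (fun X => cmap (@linprev_mult_continuous R X)) _).
move=> X Y f; apply/continuousEP => FF; apply: linprev_eq => h /=.
by congr (linprev_fun FF _); apply: lsc_eq.
Defined.

Definition PP1 : monad KHaus.
Proof.
refine (@Monad KHaus PP1_functor PP1_eta PP1_mu _ _ _).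
- move=> X; apply/continuousEP => F; apply: linprev_eq => h /=.
  by congr (linprev_fun F _); apply: lsc_eq.
- by move=> X; apply/continuousEP => F; apply: linprev_eq.
- move=> X; apply/continuousEP => F; apply: linprev_eq => h /=.
  by congr (linprev_fun F _); apply: lsc_eq.
Defined.

Definition PADP1_functor : functor KHaus KHaus.
Proof.
refine (@Functor KHaus KHaus (fork_khaus R)
  (fun X Y f => cmap (@fork_map_continuous R X Y f)) _ _).
- move=> X; apply/continuousEP => F; apply: fork_eq => h /=.
  + by congr (fork_lo F _); apply: lsc_eq.
  + by congr (fork_up F _); apply: lsc_eq.
- move=> X Y Z g f; apply/continuousEP => F; apply: fork_eq => h /=.
  + by congr (fork_lo F _); apply: lsc_eq.
  + by congr (fork_up F _); apply: lsc_eq.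
Defined.

Definition PADP1_eta : nat_trans (functor_id KHaus) PADP1_functor.
Proof.
refine (@NatTrans KHaus KHaus (functor_id KHaus) PADP1_functor
  (fun X => cmap (@fork_unit_continuous R X)) _).
by move=> X Y f; apply/continuousEP => x; apply: fork_eq.
Defined.

Definition PADP1_mu :
  nat_trans (functor_comp PADP1_functor PADP1_functor) PADP1_functor.
Proof.
refine (@NatTrans KHaus KHaus (functor_comp PADP1_functor PADP1_functor)
  PADP1_functor (fun X => cmap (@fork_mult_continuous R X)) _).
move=> X Y f; apply/continuousEP => FF; apply: fork_eq => h /=.
- by congr (fork_lo FF _); apply: lsc_eq.
- by congr (fork_up FF _); apply: lsc_eq.
Defined.

Definition PADP1 : monad KHaus.
Proof.
refine (@Monad KHaus PADP1_functor PADP1_eta PADP1_mu _ _ _).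
- move=> X; apply/continuousEP => F; apply: fork_eq => h /=.
  + by congr (fork_lo F _); apply: lsc_eq.
  + by congr (fork_up F _); apply: lsc_eq.
- by move=> X; apply/continuousEP => F; apply: fork_eq.
- move=> X; apply/continuousEP => F; apply: fork_eq => h /=.
  + by congr (fork_lo F _); apply: lsc_eq.
  + by congr (fork_up F _); apply: lsc_eq.
Defined.

Definition is_min (A : set (\bar R)) (m : \bar R) := A m /\ lbound A m.

Definition is_rADP (X : khaus)
    (f : continuousType (lens (linprev_khaus R X)) (fork R X)) :=
  forall (L : lens (linprev_khaus R X)) (h : lsc R X),
    is_min [set (G : linprev R X) h | G in (L : set (linprev R X))]
      (fork_lo (f L) h) /\
    fork_up (f L) h =
      ereal_sup [set (G : linprev R X) h | G in (L : set (linprev R X))].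

Definition sADP_set (X : topologicalType) (F : fork R X) : set (linprev R X) :=
  [set G | forall h, (fork_lo F h <= G h)%E /\ (G h <= fork_up F h)%E].

Definition is_sADP (X : khaus)
    (f : continuousType (fork R X) (lens (linprev_khaus R X))) :=
  forall F : fork R X, (f F : set (linprev R X)) = sADP_set F.
End prevision_monads.

(* Main.v *)
Require Import Defs.
From mathcomp Require Import all_boot all_order all_algebra.
From mathcomp Require Import all_classical all_reals.
From mathcomp Require Import topology normedtype ereal.
From mathcomp Require Import lra.

Set Implicit Arguments.
Unset Strict Implicit.
Unset Printing Implicit Defensive.

Import Order.TTheory GRing.Theory Num.Theory.
Import numFieldNormedType.Exports.

Local Open Scope classical_set_scope.
Local Open Scope ring_scope.

(* A normalized fork is determined by the values of its upper part F^+ on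
   continuous functions g, since F^-(g) = M - F^+(M - g) for g <= M; and a
   linear prevision G lies in s(F) as soon as G(g) <= F^+(g) for all such g.
   Everything then rests on a Hahn-Banach theorem for sublinear functionals on
   the cone of nonnegative continuous functions: below a sublinear l there is a
   linear functional that is >= c at a for all (a, c) in a prescribed cone of
   constraints with c <= l(a).
   - The constraint (g, F^+(g)) gives r(s(F)) = F.
   - Given u : Y -> fork X and G <= FF^+(y |-> u(y)^+(_)), the constraints
     (y |-> u(y)^+(g), G(g)) lift G to some GG in s(FF) on Y. The choices
     u = eta o f, u(G) = (G, G) and u = id give respectively the naturality of
     s and the two equations about e.
   - s is continuous: the box part by compactness, the diamond part because
     imposing finitely many constraints, one at a time, is stable under small
     perturbations of F. *)

(** * Hahn-Banach for sublinear states *)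

Section sublinear_states.
Variables (R : realType) (X : khaus).
Implicit Types (g a : cpos R X) (l m : cpos R X -> R) (c t : R).

Definition sublinear_state l := cpos_state l /\
  forall g1 g2, l (cpos_add g1 g2) <= l g1 + l g2.

Definition linear_state l := cpos_state l /\
  forall g1 g2, l (cpos_add g1 g2) = l g1 + l g2.

Definition cpos0 : cpos R X := cpos_cst X (lexx 0).

Lemma state_eq l g1 g2 : cpos_state l -> g1 =1 g2 -> l g1 = l g2.
Proof.
by move=> Hl e; apply/eqP; rewrite eq_le !state_mono// => x; rewrite e.
Qed.

Lemma state0 l : cpos_state l -> l cpos0 = 0.
Proof.
move=> Hl; rewrite -(mul0r (l cpos0)) -(state_scale Hl (lexx 0)).
by apply: state_eq => // x /=; rewrite mul0r.
Qed.

Lemma state_cst l c (c0 : 0 <= c) : cpos_state l -> l (cpos_cst X c0) = c.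
Proof.
move=> Hl; rewrite -[RHS]addr0 -(state0 Hl) -(state_shift Hl c0).
by apply: state_eq => // x /=; rewrite addr0.
Qed.

(** The inequality for t > 0 is enough: applied to 1/t it yields the reverse one, and applied to 1/2
    at the zero function it forces l(0) = 0, which settles t = 0. *)
Lemma sublinear_stateI l :
  (forall g, 0 <= l g) ->
  (forall g1 g2, (forall x, g1 x <= g2 x) -> l g1 <= l g2) ->
  (forall t (t0 : 0 <= t) g, 0 < t -> l (cpos_scale t0 g) <= t * l g) ->
  (forall c (c0 : 0 <= c) g, l (cpos_add (cpos_cst X c0) g) = c + l g) ->
  (forall g1 g2, l (cpos_add g1 g2) <= l g1 + l g2) ->
  sublinear_state l.
Proof.
move=> l0 lm lZ lc lD; split => //; split => // t t0 g.
have le g1 g2 : g1 =1 g2 -> l g1 = l g2.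
  by move=> e; apply/eqP; rewrite eq_le !lm// => x; rewrite e.
have [t_gt0|t_le0] := ltP 0 t; last first.
  have te : t = 0 by apply/eqP; rewrite eq_le t_le0.
  have z0 : l cpos0 <= 2^-1 * l cpos0.
    have h0 : 0 <= 2^-1 :> R by rewrite invr_ge0.
    rewrite [leLHS](_ : _ = l (cpos_scale h0 cpos0)).
      by apply: lZ; rewrite invr_gt0.
    by apply: le => x /=; rewrite mulr0.
  rewrite (@le _ cpos0) => [|x /=]; last by rewrite te mul0r.
  by rewrite te mul0r; have := l0 cpos0; lra.
apply/eqP; rewrite eq_le lZ//=.
have ti0 : 0 <= t^-1 by rewrite invr_ge0.
rewrite -ler_pdivlMl// [leLHS](_ : _ = l (cpos_scale ti0 (cpos_scale t0 g))).
  by apply: lZ; rewrite invr_gt0.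
by apply: le => x /=; rewrite mulrA mulVf ?mul1r// gt_eqF.
Qed.

(** [A a c] stands for the requirement that a functional be at least c at a. The closure properties
    are what makes the infimum in [constrain] sublinear. *)
Record cpos_cone (A : cpos R X -> R -> Prop) : Prop := CposCone {
  cone0 : A cpos0 0;
  cone_add : forall a1 a2 c1 c2, A a1 c1 -> A a2 c2 ->
    A (cpos_add a1 a2) (c1 + c2);
  cone_scale : forall t (t0 : 0 <= t) a c, A a c ->
    A (cpos_scale t0 a) (t * c) }.

(** The cone of a single constraint. Membership is pointwise, so that functions built by different
    operations need not be equal as records. *)
Lemma cpos_cone_ray a r : cpos_cone (fun b c =>
  exists2 t : R, 0 <= t & (forall x, b x = t * a x) /\ c = t * r).
Proof.
split.
- by exists 0; rewrite ?mul0r//; split => // x /=; rewrite mul0r.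
- move=> b1 b2 _ _ [s s0 [E1 ->]] [t t0 [E2 ->]].
  exists (s + t); first exact: addr_ge0.
  by split => [x|]; rewrite /= ?E1 ?E2 mulrDl.
- move=> s s0 b _ [t t0 [E ->]]; exists (s * t); first exact: mulr_ge0.
  by split => [x|]; rewrite /= ?E mulrA.
Qed.

Section constrain.
Variables (l : cpos R X -> R) (A : cpos R X -> R -> Prop).
Hypotheses (Hl : sublinear_state l) (HA : cpos_cone A).
Hypothesis Al : forall a c, A a c -> c <= l a.

(* The largest sublinear state below [l] whose linear minorants are all at
   least [c] at [a], for [A a c]. *)
Definition constrain g : R :=
  inf [set r | exists a c, A a c /\ r = l (cpos_add g a) - c].

Lemma constrain_ge0 a c g : A a c -> 0 <= l (cpos_add g a) - c.
Proof.
move=> /Al ca; rewrite subr_ge0 (le_trans ca)//; apply: state_mono Hl.1 _ _ _.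
by move=> x /=; rewrite lerDr cpos_ge0.
Qed.

Lemma constrain_le a c g : A a c -> constrain g <= l (cpos_add g a) - c.
Proof.
move=> Aac; apply: ge_inf; last by exists a, c.
by exists 0 => _ [b [d [Abd ->]]]; exact: constrain_ge0.
Qed.

Lemma le_constrain g r :
  (forall a c, A a c -> r <= l (cpos_add g a) - c) -> r <= constrain g.
Proof.
move=> H; apply: lb_le_inf => [|_ [a [c [Aac ->]]]]; last exact: H.
by exists (l (cpos_add g cpos0) - 0), cpos0, 0; split=> //; exact: cone0.
Qed.

Lemma constrain_sublinear : sublinear_state constrain.
Proof.
have sl := Hl.1.
apply: sublinear_stateI.
- by move=> g; apply: le_constrain => a c; exact: constrain_ge0.
- move=> g1 g2 g12; apply: le_constrain => a c Aac.
  apply: le_trans (constrain_le _ Aac) _; rewrite lerD2r.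
  by apply: state_mono => // x /=; rewrite lerD2r.
- move=> t t0 g t_gt0; rewrite -ler_pdivrMl//; apply: le_constrain => a c Aac.
  rewrite ler_pdivrMl// mulrBr -(state_scale sl t0).
  apply: le_trans (constrain_le _ (cone_scale HA t0 Aac)) _.
  by rewrite lerD2r; apply: state_mono => // x /=; rewrite mulrDr.
- move=> c c0 g.
  have E a : l (cpos_add (cpos_add (cpos_cst X c0) g) a) = c + l (cpos_add g a).
    by rewrite -(state_shift sl c0); apply: state_eq => // x /=; rewrite addrA.
  apply/eqP; rewrite eq_le; apply/andP; split.
    rewrite -lerBlDl; apply: le_constrain => a d Aad.
    by rewrite lerBlDl addrA -E; exact: constrain_le.
  apply: le_constrain => a d Aad; rewrite E -addrA lerD2l.
  exact: constrain_le.
- move=> g1 g2; rewrite -lerBlDr; apply: le_constrain => a1 c1 A1.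
  rewrite lerBlDr -lerBlDl; apply: le_constrain => a2 c2 A2.
  rewrite lerBlDl addrACA -opprD.
  apply: le_trans (constrain_le _ (cone_add HA A1 A2)) _; rewrite lerD2r.
  apply: le_trans (Hl.2 _ _); apply: state_mono => // x /=.
  by rewrite addrACA.
Qed.

Lemma constrain_below g : constrain g <= l g.
Proof.
apply: le_trans (constrain_le _ (cone0 HA)) _; rewrite subr0.
by apply: state_mono Hl.1 _ _ _ => x /=; rewrite addr0.
Qed.

(* Evaluate m <= constrain at M - a, for M an upper bound of a. *)
Lemma constrain_cone m a c : linear_state m ->
  (forall g, m g <= constrain g) -> A a c -> c <= m a.
Proof.
move=> Hm ml Aac; have [M M0 aM] := cpos_bounded a.
have E : cpos_add (cpos_compl a M) a =1 cpos_cst X M0.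
  move=> x /=; have /max_idPl -> : 0 <= M - a x by rewrite subr_ge0.
  by rewrite subrK.
have := le_trans (ml (cpos_compl a M)) (constrain_le _ Aac).
have := Hm.2 (cpos_compl a M) a.
rewrite (state_eq Hm.1 E) (state_eq Hl.1 E) (state_cst _ Hm.1).
by rewrite (state_cst _ Hl.1); lra.
Qed.
End constrain.

(** Zorn's lemma: a nonempty chain of sublinear states is bounded below by its pointwise infimum. *)
Lemma minimal_state p : sublinear_state p ->
  exists l, [/\ sublinear_state l, forall g, l g <= p g &
    forall m, sublinear_state m -> (forall g, m g <= l g) ->
      forall g, m g = l g].
Proof.
move=> Hp.
pose T := {l | sublinear_state l /\ forall g, l g <= p g}.
pose t0 : T := exist _ p (conj Hp (fun g => lexx _)).
(* The order is reversed because [ZL_preorder] produces maximal elements. *)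
pose below (u v : T) : bool := `[< forall g, sval v g <= sval u g >].
have [|u v w|B tB|[l [Hl lp]] lmin] := @ZL_preorder T t0 below.
- by move=> u; apply/asboolP.
- move=> /asboolP vu /asboolP uw; apply/asboolP => g.
  exact: le_trans (uw g) (vu g).
- have [->|/set0P[u0 Bu0]] := eqVneq B set0; first by exists t0.
  pose q g := inf [set sval u g | u in B].
  have q_le u g : B u -> q g <= sval u g.
    move=> Bu; apply: ge_inf; last by exists u.
    by exists 0 => _ [v Bv <-]; exact: state_ge0 (svalP v).1.1 _.
  have le_q r g : (forall u, B u -> r <= sval u g) -> r <= q g.
    move=> H; apply: lb_le_inf; first by exists (sval u0 g), u0.
    by move=> _ [u Bu <-]; exact: H.
  have Hq : sublinear_state q.
    apply: sublinear_stateI.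
    + by move=> g; apply: le_q => u _; exact: state_ge0 (svalP u).1.1 _.
    + move=> g1 g2 g12; apply: le_q => u Bu; apply: le_trans (q_le _ _ Bu) _.
      exact: state_mono (svalP u).1.1 _ _ g12.
    + move=> t tt0 g t_gt0; rewrite -ler_pdivrMl//; apply: le_q => u Bu.
      rewrite ler_pdivrMl// -(state_scale (svalP u).1.1 tt0); exact: q_le.
    + move=> c c0 g; apply/eqP; rewrite eq_le; apply/andP; split.
        rewrite -lerBlDl; apply: le_q => u Bu.
        rewrite lerBlDl -(state_shift (svalP u).1.1 c0); exact: q_le.
      apply: le_q => u Bu; rewrite (state_shift (svalP u).1.1) lerD2l.
      exact: q_le.
    + move=> g1 g2; rewrite -lerBlDr; apply: (le_q) => u Bu.
      rewrite lerBlDr -lerBlDl; apply: le_q => v Bv; rewrite lerBlDl.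
      (* Of two members of the chain, the smaller one is subadditive and bounded by the other. *)
      have [/asboolP vu|/asboolP uv] := tB _ _ Bu Bv.
        apply: le_trans (q_le _ _ Bv) _; apply: le_trans ((svalP v).1.2 _ _) _.
        by rewrite lerD2r.
      apply: le_trans (q_le _ _ Bu) _; apply: le_trans ((svalP u).1.2 _ _) _.
      by rewrite lerD2l.
  have qp g : q g <= p g by apply: le_trans (q_le _ _ Bu0) _; exact: (svalP u0).2.
  exists (exist _ q (conj Hq qp)) => u Bu; apply/asboolP => g; exact: q_le.
exists l; split => // m Hm ml g; apply/eqP; rewrite eq_le ml/=.
have mp g' : m g' <= p g' by exact: le_trans (ml g') (lp g').
have mB : below (exist _ l (conj Hl lp)) (exist _ m (conj Hm mp)) by apply/asboolP.
by have /asboolP := lmin _ mB; apply.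
Qed.

(* A minimal sublinear l equals its constraint by the ray of (a, l(a)), whence
   l(g) <= l(g + a) - l(a). *)
Lemma exists_linear_state p : sublinear_state p ->
  exists2 l, linear_state l & forall g, l g <= p g.
Proof.
move=> /minimal_state[l [Hl lp lmin]]; exists l => //; split; first exact: Hl.1.
move=> g a; apply/eqP; rewrite eq_le Hl.2/=.
pose A (b : cpos R X) c :=
  exists2 t : R, 0 <= t & (forall x, b x = t * a x) /\ c = t * l a.
have HA : cpos_cone A := cpos_cone_ray a (l a).
have Al b c : A b c -> c <= l b.
  move=> [t t0 [E ->]]; rewrite -(state_scale Hl.1 t0).
  by apply: state_mono Hl.1 _ _ _ => x /=; rewrite E.
have Aa : A a (l a) by exists 1; rewrite ?mul1r//; split => // x; rewrite mul1r.
have := constrain_le Hl Al g Aa.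
rewrite (lmin _ (constrain_sublinear Hl HA Al) (constrain_below Hl HA Al)).
by rewrite lerBrDr.
Qed.

(** Any linear functional below [constrain p A] will do, and one exists because [constrain p A] is
    itself sublinear. *)
Lemma exists_linear_state_cone p (A : cpos R X -> R -> Prop) :
  sublinear_state p -> cpos_cone A -> (forall a c, A a c -> c <= p a) ->
  exists l, [/\ linear_state l, forall g, l g <= p g &
    forall a c, A a c -> c <= l a].
Proof.
move=> Hp HA Ap.
have [l Hl lp] := exists_linear_state (constrain_sublinear Hp HA Ap).
exists l; split=> // [g|a c]; first exact: le_trans (lp g) (constrain_below _ _ _ _).
exact: constrain_cone lp.
Qed.
End sublinear_states.

(** * Forks and linear previsions as states *)

Section fork_states.
Variables (R : realType) (X : khaus).
Implicit Types (g a : cpos R X) (h k : lsc R X) (F : fork R X).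
Local Open Scope ereal_scope.

Lemma cpos_lsc_add g1 g2 :
  cpos_lsc (cpos_add g1 g2) = lsc_add (cpos_lsc g1) (cpos_lsc g2).
Proof. exact: lsc_eq. Qed.

Lemma prevision_mono (f : lsc R X -> \bar R) h k :
  is_prevision f -> lsc_le h k -> f h <= f k.
Proof. by move=> Pf; exact: (prevision_scott Pf).1. Qed.

Lemma prevision_state (f : lsc R X -> \bar R) : is_prevision f -> normalized f ->
  cpos_state (fun g => fine (f (cpos_lsc g))).
Proof.
move=> Pf Nf; have ff g := prevision_fin g Pf Nf; split.
- by move=> g; rewrite fine_ge0// prevision_ge0.
- move=> g1 g2 g12; rewrite -lee_fin !fineK//.
  by apply: prevision_mono => // x; rewrite lee_fin.
- move=> t t0 g; rewrite (_ : cpos_lsc _ = lsc_scale t0 (cpos_lsc g)).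
    by rewrite prevision_scale// fineM.
  exact: lsc_eq.
- by move=> c c0 g; rewrite cpos_lsc_add prevision_cst// fineD.
Qed.

(** The extension [cpos_ext] is a supremum over continuous minorants; by monotonicity it agrees with
    [l] on continuous functions. *)
Lemma linear_state_linprev (l : cpos R X -> R) : linear_state l ->
  exists G : linprev R X, forall g, G (cpos_lsc g) = (l g)%:E.
Proof.
move=> [Hl lD].
have lext h k : cpos_ext l (lsc_add h k) = cpos_ext l h + cpos_ext l k.
  apply/eqP; rewrite eq_le; apply/andP; split.
    by apply: cpos_add_ext => // g1 g2; rewrite lD.
  by apply: cpos_ext_add => // g1 g2; rewrite lD.
exists (LinPrev (conj (cpos_ext_prevision Hl) lext) (cpos_ext_normalized Hl)).
move=> g /=; apply/eqP; rewrite eq_le; apply/andP; split.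
  apply: ge_ereal_sup => _ [g' gg' <-]; rewrite lee_fin.
  by apply: state_mono => // x; rewrite -lee_fin; exact: gg'.
by apply: cpos_ext_ub => x.
Qed.

(** Every lower semicontinuous function is the directed supremum of the continuous functions below
    it, and [f] preserves this supremum. *)
Lemma prevision_le_cpos (f f' : lsc R X -> \bar R) :
  is_prevision f -> is_prevision f' ->
  (forall g, f (cpos_lsc g) <= f' (cpos_lsc g)) -> forall h, f h <= f' h.
Proof.
move=> Pf Pf' ff' h.
rewrite ((prevision_scott Pf).2 _ _ (cpos_below_directed h) (cpos_below_lub h)).
apply: ge_ereal_sup => _ [_ [g gh <-] <-]; apply: le_trans (ff' g) _.
exact: prevision_mono.
Qed.

Lemma fork_up_fin F g : fork_up F (cpos_lsc g) \is a fin_num.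
Proof.
exact: prevision_fin (fork_upP F).1 (@fork_up_normalized _ _ F).
Qed.

Lemma fork_lo_fin F g : fork_lo F (cpos_lsc g) \is a fin_num.
Proof.
exact: prevision_fin (fork_loP F).1 (@fork_lo_normalized _ _ F).
Qed.

Lemma linprev_fin (G : linprev R X) g : G (cpos_lsc g) \is a fin_num.
Proof. exact: prevision_fin (linprevP G).1 (@linprev_normalized _ _ G). Qed.

Lemma fork_up_sublinear F :
  sublinear_state (fun g => fine (fork_up F (cpos_lsc g))).
Proof.
split; first exact: prevision_state (fork_upP F).1 (@fork_up_normalized _ _ F).
move=> g1 g2; rewrite -lee_fin EFinD !fineK ?fork_up_fin// cpos_lsc_add.
exact: (fork_upP F).2.
Qed.

Lemma linprev_linear_state (G : linprev R X) :
  linear_state (fun g => fine (G (cpos_lsc g))).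
Proof.
split; first exact: prevision_state (linprevP G).1 (@linprev_normalized _ _ G).
by move=> g1 g2; rewrite cpos_lsc_add (linprevP G).2 fineD// linprev_fin.
Qed.

(** For g <= M, the identity F^-(g) + F^+(M - g) = M reverses inequalities between upper parts. *)
Lemma fork_lo_anti F F' :
  (forall g, fork_up F (cpos_lsc g) <= fork_up F' (cpos_lsc g)) ->
  forall h, fork_lo F' h <= fork_lo F h.
Proof.
move=> FF'; apply: prevision_le_cpos (fork_loP F').1 (fork_loP F).1 _ => g.
have [M M0 gM] := cpos_bounded g.
have := fork_compl F M0 gM; have := fork_compl F' M0 gM.
have := FF' (cpos_compl g M).
rewrite -(fineK (fork_up_fin F _)) -(fineK (fork_up_fin F' _)).
rewrite -(fineK (fork_lo_fin F _)) -(fineK (fork_lo_fin F' _)).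
by rewrite !lee_fin -!EFinD => ? [?] [?]; lra.
Qed.

Lemma fork_eq_up F F' :
  (forall g, fork_up F (cpos_lsc g) = fork_up F' (cpos_lsc g)) -> F = F'.
Proof.
move=> e; apply: fork_eq => h; apply/eqP; rewrite eq_le; apply/andP; split.
- by apply: fork_lo_anti => g; rewrite e.
- by apply: fork_lo_anti => g; rewrite e.
- apply: (prevision_le_cpos (fork_upP F).1 (fork_upP F').1) => g.
  by rewrite e.
- apply: (prevision_le_cpos (fork_upP F').1 (fork_upP F).1) => g.
  by rewrite e.
Qed.

Lemma sADP_setP F (G : linprev R X) :
  sADP_set F G <-> forall g, G (cpos_lsc g) <= fork_up F (cpos_lsc g).
Proof.
split=> [H g|H h]; first by have [] := H (cpos_lsc g).
(* As G is both parts of [linprev_fork G], the bounds from above also give those from below. *)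
split; first exact: (@fork_lo_anti (linprev_fork G)).
exact: prevision_le_cpos (linprevP G).1 (fork_upP F).1 _ _.
Qed.

(** One inequality suffices: since G(g) + G(M - g) = M for g <= M, applying it to M - g reverses
    it. *)
Lemma linprev_eq_le (G G' : linprev R X) :
  (forall g, G (cpos_lsc g) <= G' (cpos_lsc g)) -> G = G'.
Proof.
move=> /(sADP_setP (linprev_fork G') G).2 H; apply: linprev_eq => h.
by have [/= ? ?] := H h; apply/eqP; rewrite eq_le; apply/andP.
Qed.

Lemma exists_sADP_cone F (A : cpos R X -> R -> Prop) : cpos_cone A ->
  (forall a c, A a c -> c%:E <= fork_up F (cpos_lsc a)) ->
  exists2 G, sADP_set F G & forall a c, A a c -> c%:E <= G (cpos_lsc a).
Proof.
move=> HA AF.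
have [|l [Hl lF lA]] := exists_linear_state_cone (fork_up_sublinear F) HA.
  by move=> a c /AF; rewrite -{1}(fineK (fork_up_fin F a)).
have [G GE] := linear_state_linprev Hl; exists G.
  by apply/sADP_setP => g; rewrite GE -[leRHS]fineK ?fork_up_fin// lee_fin.
by move=> a c /lA; rewrite GE.
Qed.

End fork_states.

(** * The retraction *)

Section rADP.
Variables (R : realType) (X : khaus).
Local Open Scope ereal_scope.
Local Notation TX := (linprev_khaus R X).
Implicit Types (h k : lsc R X) (L : lens TX) (G : linprev R X).

Lemma lte_between (u v : \bar R) : 0 <= u -> u < v ->
  exists2 a : R, u < a%:E & a%:E < v.
Proof.
case: u => [u||]// _; case: v => [v||]//; last first.
  by exists (u + 1)%R; rewrite ?ltry// lte_fin ltrDl.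
by rewrite lte_fin => uv; exists ((u + v) / 2)%R; rewrite lte_fin; lra.
Qed.

(** If the infimum m were not attained, h would locally exceed a real above m; by compactness one
    such real would serve on all of K, contradicting the choice of m. *)
Lemma lsc_compact_min (Y : topologicalType) (h : lsc R Y) (K : set Y) :
  compact K -> K !=set0 -> exists2 y, K y & forall z, K z -> h y <= h z.
Proof.
move=> cK [y0 Ky0]; pose m := ereal_inf (h @` K).
have m0 : 0 <= m by apply: le_ereal_inf_tmp => _ [y _ <-]; exact: lsc_ge0.
have mK y : K y -> m <= h y by move=> Ky; apply: ereal_inf_lbound; exists y.
have [[y Ky hy]|nK] := pselect (exists2 y, K y & h y = m).
  by exists y => // z; rewrite hy; exact: mK.
have mltK y : K y -> m < h y.
  move=> Ky; rewrite lt_neqAle mK// andbT; apply/eqP => e.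
  by apply: nK; exists y.
have [a ma aK] : exists2 a : R, m < a%:E & forall y, K y -> a%:E < h y.
  apply: (@compact_ideal _ K [set S | exists2 a : R, m < a%:E &
    forall y, S y -> a%:E < h y] cK) => /=.
  - by have [a ma _] := lte_between m0 (mltK _ Ky0); exists a.
  - by move=> A B AB [a ma aB]; exists a => // y /AB; exact: aB.
  - move=> A B [a ma aA] [b mb bB]; exists (Num.min a b).
      by rewrite EFin_min lt_min ma.
    by move=> y [/aA|/bB] H; rewrite EFin_min gt_min H ?orbT.
  - move=> y Ky; have [a ma ay] := lte_between m0 (mltK _ Ky).
    by have [V yV VH] := lsc_lower_semicontinuous ay; exists V => //; exists a.
exfalso; have : a%:E <= m.
  by apply: le_ereal_inf_tmp => _ [y Ky <-]; exact/ltW/aK.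
by rewrite leNgt ma.
Qed.

Definition lens_lo L h : \bar R :=
  ereal_inf [set G h | G in (L : set (linprev R X))].
Definition lens_up L h : \bar R :=
  ereal_sup [set G h | G in (L : set (linprev R X))].

Lemma lens_lo_attained L h : exists2 G, lens_set L G & lens_lo L h = G h.
Proof.
have [G LG Gmin] := lsc_compact_min (linprev_eval h)
  (@lens_compact TX L) (lensP L).1.
exists G => //; apply/eqP; rewrite eq_le; apply/andP; split.
  by apply: ereal_inf_lbound; exists G.
by apply: le_ereal_inf_tmp => _ [G' LG' <-]; exact: Gmin.
Qed.

Lemma lens_lo_le L h G : lens_set L G -> lens_lo L h <= G h.
Proof. by move=> LG; apply: ereal_inf_lbound; exists G. Qed.

Lemma lens_up_ge L h G : lens_set L G -> G h <= lens_up L h.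
Proof. by move=> LG; apply: ereal_sup_ubound; exists G. Qed.

Lemma lens_lo_prevision L : is_prevision (lens_lo L).
Proof.
split.
- move=> h; have [G _ ->] := lens_lo_attained L h.
  exact: prevision_ge0 (linprevP G).1 _.
- have mono h k : lsc_le h k -> lens_lo L h <= lens_lo L k.
    move=> hk; have [G LG ->] := lens_lo_attained L k.
    by apply: le_trans (lens_lo_le _ LG) _; exact: prevision_mono (linprevP G).1 hk.
  split => // D h dD lD; have [[k0 Dk0] DD] := dD.
  apply/eqP; rewrite eq_le; apply/andP; split; last first.
    by apply: ge_ereal_sup => _ [k Dk <-]; apply: mono; exact: lD.1.
  rewrite leNgt; apply/negP => sl.
  have [|a sa alo] := lte_between _ sl.
    apply: le_trans (ereal_sup_ubound _); last by exists k0.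
    by have [G _ ->] := lens_lo_attained L k0; exact: prevision_ge0 (linprevP G).1 _.
  (* Each G in L exceeds a at some member of D, and so do its neighbours; compactness and
     directedness give one k for all of L. *)
  have [k Dk aL] : exists2 k, D k & forall G, lens_set L G -> a%:E < G k.
    apply: (@compact_ideal TX L [set S : set (linprev R X) | exists2 k, D k &
      forall G, S G -> a%:E < G k] (@lens_compact TX L)) => /=.
    + by exists k0.
    + by move=> A B AB [k Dk kB]; exists k => // G /AB; exact: kB.
    + move=> A B [k Dk kA] [l Dl lB]; have [m [Dm km lm]] := DD _ _ Dk Dl.
      exists m => // G [AG|BG].
        by apply: lt_le_trans (kA _ AG) _; exact: prevision_mono (linprevP G).1 km.
      by apply: lt_le_trans (lB _ BG) _; exact: prevision_mono (linprevP G).1 lm.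
    + move=> G LG; have : a%:E < G h by apply: lt_le_trans alo (lens_lo_le _ LG).
      rewrite ((prevision_scott (linprevP G).1).2 _ _ dD lD).
      move=> /ereal_sup_gt[_ [k Dk <-] ak].
      exists [set G' : linprev R X | a%:E < G' k]; last by exists k.
      by apply: open_nbhs_nbhs; split => //; exact: linprev_open.
  have [G LG e] := lens_lo_attained L k.
  have : lens_lo L k <= a%:E.
    by apply: le_trans (ltW sa); apply: ereal_sup_ubound; exists k.
  by rewrite e leNgt aL.
- move=> a a0 h; apply/eqP; rewrite eq_le; apply/andP; split.
    have [G LG ->] := lens_lo_attained L h.
    by rewrite -(prevision_scale (linprevP G).1); exact: lens_lo_le.
  have [G LG ->] := lens_lo_attained L (lsc_scale a0 h).
  rewrite (prevision_scale (linprevP G).1) lee_wpmul2l ?lee_fin//.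
  exact: lens_lo_le.
Qed.

Lemma lens_up_prevision L : is_prevision (lens_up L).
Proof.
have [[G0 LG0] _] := lensP L.
split.
- move=> h; apply: le_trans (lens_up_ge _ LG0).
  exact: prevision_ge0 (linprevP G0).1 _.
- have mono h k : lsc_le h k -> lens_up L h <= lens_up L k.
    move=> hk; apply: ge_ereal_sup => _ [G LG <-].
    by apply: le_trans (lens_up_ge _ LG); exact: prevision_mono (linprevP G).1 hk.
  split => // D h dD lD; apply/eqP; rewrite eq_le; apply/andP; split; last first.
    by apply: ge_ereal_sup => _ [k Dk <-]; apply: mono; exact: lD.1.
  apply: ge_ereal_sup => _ [G LG <-].
  rewrite ((prevision_scott (linprevP G).1).2 _ _ dD lD).
  apply: ge_ereal_sup => _ [k Dk <-]; apply: le_trans (lens_up_ge k LG) _.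
  by apply: ereal_sup_ubound; exists k.
- move=> a a0 h; rewrite /lens_up -ereal_supZl//; last first.
    by apply/set0P; exists (G0 h), G0.
  congr ereal_sup; rewrite image_comp; apply: eq_imagel => G LG /=.
  exact: prevision_scale (linprevP G).1 _ _ _.
Qed.

Definition rADP_fork L : fork R X.
Proof.
refine (@Fork R X (lens_lo L) (lens_up L)
  (conj (lens_lo_prevision L) _) (conj (lens_up_prevision L) _) _ _ _ _).
- move=> h k; have [G LG ->] := lens_lo_attained L (lsc_add h k).
  by rewrite (linprevP G).2 leeD//; exact: lens_lo_le.
- move=> h k; apply: ge_ereal_sup => _ [G LG <-].
  by rewrite (linprevP G).2 leeD//; exact: lens_up_ge.
- move=> h; apply/eqP; rewrite eq_le; apply/andP; split.
    have [G LG ->] := lens_lo_attained L h.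
    by rewrite -linprev_normalized; exact: lens_lo_le.
  have [G LG ->] := lens_lo_attained L (lsc_add lsc_one h).
  by rewrite linprev_normalized leeD2l//; exact: lens_lo_le.
- move=> h; apply/eqP; rewrite eq_le; apply/andP; split.
    apply: ge_ereal_sup => _ [G LG <-].
    by rewrite linprev_normalized leeD2l//; exact: lens_up_ge.
  rewrite -leeBrDl//; apply: ge_ereal_sup => _ [G LG <-].
  by rewrite leeBrDl// -linprev_normalized; exact: lens_up_ge.
- move=> h k; have [G LG ->] := lens_lo_attained L h.
  apply: le_trans (lens_lo_le _ LG) _.
  by rewrite (linprevP G).2 leeD2l//; exact: lens_up_ge.
- move=> h k.
  have H G : lens_set L G -> lens_lo L h + G k <= lens_up L (lsc_add h k).
    move=> LG; apply: le_trans (lens_up_ge _ LG).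
    by rewrite (linprevP G).2 leeD2r//; exact: lens_lo_le.
  have [[G0 LG0] _] := lensP L.
  (* A finite value can be moved across the inequality; if it is infinite, a single member of the
     lens makes the right-hand side infinite. *)
  move: (prevision_ge0 (lens_lo_prevision L) h) H.
  case: (lens_lo L h) => [v||]// _ H.
    rewrite -leeBrDl//; apply: ge_ereal_sup => _ [G LG <-].
    by rewrite leeBrDl//; exact: H.
  have := H _ LG0; have := prevision_ge0 (linprevP G0).1 k.
  case: (G0 k) => [w||]//= _.
    by rewrite leye_eq => /eqP ->; exact: leey.
  by rewrite leye_eq => /eqP ->; exact: leey.
Defined.

(** Subbasic sets for F^- pull back to boxes, because the minimum is attained, and those for F^+ to
    diamonds. *)
Lemma rADP_fork_continuous : continuous (rADP_fork : lens TX -> fork R X).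
Proof.
apply: fork_continuous => h r.
- rewrite (_ : [set _ | _] = @vbox TX [set G : linprev R X | r%:E < G h]).
    by apply: vbox_open; exact: linprev_open.
  apply/seteqP; split=> L /= H.
    by move=> G LG; exact: lt_le_trans H (lens_lo_le _ LG).
  by have [G LG ->] := lens_lo_attained L h; exact: H.
- rewrite (_ : [set _ | _] = @vdiamond TX [set G : linprev R X | r%:E < G h]).
    by apply: vdiamond_open; exact: linprev_open.
  apply/seteqP; split=> L /=.
    by move=> /ereal_sup_gt[_ [G LG <-] rG]; exists G.
  by move=> [G [LG /= rG]]; exact: lt_le_trans rG (lens_up_ge _ LG).
Qed.
End rADP.

(** * The section *)

Section lower_hemicontinuity.
Variables (R : realType) (X : khaus).
Implicit Types (g x : cpos R X) (l m : cpos R X -> R).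

(* The constraint (g, r) is an infimum over t >= 0. For large t its terms are
   bounded below by t (p i g - r); for the remaining t, monotonicity in t reduces
   the bound to the finitely many multiples of delta below N * delta. *)
Lemma constrain_ray_liminf (I : Type) (W : set_system I) (p : I -> cpos R X -> R)
    m g (r : R) : Filter W -> linear_state m ->
  (forall i, sublinear_state (p i)) ->
  (forall x b, b < m x -> W [set i | b < p i x]) -> r < m g ->
  forall x b, b < m x -> W [set i | r <= p i g /\
    b < constrain (p i) (fun a c =>
      exists2 t : R, 0 <= t & (forall y, a y = t * g y) /\ c = t * r) x].
Proof.
move=> FW Hm Hp Wp rg x b bx.
pose e := m x - b; have e0 : 0 < e by rewrite /e subr_gt0.
pose d := m g - r; have d0 : 0 < d by rewrite /d subr_gt0.
have r1 : 0 < `|r| + 1 by rewrite ltr_wpDl.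
(* Moving t by at most delta changes t * r by at most e / 4; the + 1 keeps the denominator
   positive. *)
pose delta := e / 4 / (`|r| + 1).
have delta0 : 0 < delta by rewrite !divr_gt0.
have delta_r : delta * `|r| <= e / 4.
  by rewrite /delta mulrAC ler_pdivrMr// ler_pM2l ?divr_gt0// lerDl.
have kd0 (k : nat) : 0 <= k%:R * delta by rewrite mulr_ge0// ltW.
pose y k := cpos_add x (cpos_scale (kd0 k) g).
have my k : m (y k) = m x + k%:R * delta * m g.
  by rewrite Hm.2 (state_scale Hm.1).
have net N : W [set i | forall k, (k < N)%N -> m (y k) - e / 4 < p i (y k)].
  elim: N => [|N IH]; first by apply: filterS filterT.
  have : W [set i | m (y N) - e / 4 < p i (y N)].
    by apply: Wp; rewrite ltrBlDr ltrDl divr_gt0.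
  move=> WN; apply: filterS (filterI WN IH) => i [iN iIH] k.
  by rewrite ltnS leq_eqVlt => /predU1P[->|/iIH].
have Wg : W [set i | r + d / 2 < p i g] by apply: Wp; rewrite /d; lra.
(* All terms are bounded below by b' > b, so that the infimum still exceeds b strictly. This leaves
   e / 2: one e / 4 for [net], the other for rounding t to the grid. *)
pose b' := (b + m x) / 2; have bb' : b < b' by rewrite /b'; lra.
(* For t >= N * delta the bound t * (d / 2) alone reaches b'. *)
pose N := (Num.truncn (`|b'| / (delta * (d / 2)))).+1.
have Nb : b' <= N%:R * delta * (d / 2).
  rewrite -mulrA; apply: le_trans (ler_norm _) _.
  rewrite -ler_pdivrMr ?mulr_gt0 ?divr_gt0//.
  by have /andP[_ /ltW] := truncn_itv (divr_ge0 (normr_ge0 b')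
    (mulr_ge0 (ltW delta0) (ltW (divr_gt0 d0 (ltr0Sn _ 1))))).
apply: filterS (filterI Wg (net N)) => i [ig inet].
have rpg : r <= p i g by apply: ltW; apply: lt_trans ig; rewrite ltrDl divr_gt0.
split => //; apply: lt_le_trans bb' _; have sp := (Hp i).1.
apply: (le_constrain (cpos_cone_ray g r)) => a _ [t t0 [aE ->]].
have aS : p i (cpos_add x a) = p i (cpos_add x (cpos_scale t0 g)).
  by apply: state_eq => // z /=; rewrite aE.
pose k := Num.truncn (t / delta).
have /andP[kt tk] : k%:R * delta <= t < (k%:R + 1) * delta.
  have /andP[k1 k2] := truncn_itv (divr_ge0 t0 (ltW delta0)).
  by rewrite -ler_pdivlMr// k1 -ltr_pdivrMr// natr1.
(* For small t, compare with the grid point k * delta just below t. *)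
have [kN|Nk] := ltnP k N.
  have ixy : p i (y k) <= p i (cpos_add x a).
    by rewrite aS; apply: state_mono => // z /=; rewrite lerD2l ler_wpM2r// cpos_ge0.
  have tr : t * r - k%:R * delta * r <= e / 4.
    apply: le_trans delta_r; rewrite -mulrBl; apply: le_trans (ler_norm _) _.
    rewrite normrM ler_wpM2r// ger0_norm ?subr_ge0// lerBlDl.
    by have := ltW tk; rewrite mulrDl mul1r.
  have kd : 0 <= k%:R * delta * d by rewrite mulr_ge0// ltW.
  have := inet _ kN; rewrite my; rewrite /d mulrBr in kd.
  by rewrite /b'; move: tr kd ixy; rewrite /e; lra.
(* For large t, the nonnegative x is dropped. *)
have px : t * p i g <= p i (cpos_add x a).
  rewrite -(state_scale sp t0) aS; apply: state_mono => // z /=.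
  by rewrite lerDr cpos_ge0.
have Nt : N%:R * delta <= t.
  by apply: le_trans kt; rewrite ler_wpM2r ?ler_nat// ltW.
have : N%:R * delta * (d / 2) <= t * (p i g - r).
  by apply: ler_pM; [exact: kd0|lra|exact: Nt|by rewrite lerBrDl; exact: ltW ig].
by rewrite mulrBr; lra.
Qed.

(** Induction on the constraints with p general: imposing the first one replaces p by a constrained
    family whose lower limit still dominates m, by [constrain_ray_liminf]. *)
Lemma linear_state_liminf (I : Type) (W : set_system I) m
    (s : seq (cpos R X * R)) : Filter W -> linear_state m ->
  all (fun c => c.2 < m c.1) s -> forall p : I -> cpos R X -> R,
  (forall i, sublinear_state (p i)) ->
  (forall x b, b < m x -> W [set i | b < p i x]) ->
  W [set i | exists l, [/\ linear_state l, forall x, l x <= p i x &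
    all (fun c => c.2 <= l c.1) s]].
Proof.
move=> FW Hm; elim: s => [_|[g r] s IH /= /andP[rg sm]] p Hp Wp.
  apply: filterS filterT => i _; have [l Hl lp] := exists_linear_state (Hp i).
  by exists l.
pose A := fun (a : cpos R X) (c : R) =>
  exists2 t : R, 0 <= t & (forall y, a y = t * g y) /\ c = t * r.
have HA : cpos_cone A := cpos_cone_ray g r.
have Ap i : r <= p i g -> forall a c, A a c -> c <= p i a.
  move=> rp a _ [t t0 [aE ->]].
  apply: (@le_trans _ _ (t * p i g)); first by rewrite ler_wpM2l.
  rewrite -(state_scale (Hp i).1 t0); apply: state_mono (Hp i).1 _ _ _ => y /=.
  by rewrite aE.
(* The default p i keeps every q i sublinear; the constraint is admissible for W-almost all i. *)
pose q i := if r <= p i g then constrain (p i) A else p i.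
have Hq i : sublinear_state (q i).
  rewrite /q; case: ifPn => // rp.
  exact: constrain_sublinear (Hp i) HA (Ap i rp).
have Wq x b : b < m x -> W [set i | b < q i x].
  move=> bx; have := constrain_ray_liminf FW Hm Hp Wp rg bx.
  by apply: filterS => i [rp bp] /=; rewrite /q rp.
have WA := constrain_ray_liminf FW Hm Hp Wp rg (x := g) rg.
apply: filterS (filterI WA (IH sm q Hq Wq)) => i [[rp _] [l [Hl lq sl]]].
exists l; rewrite sl andbT; move: lq; rewrite /q rp => lq; split=> // [x|].
  exact: le_trans (lq x) (constrain_below (Hp i) HA (Ap i rp) x).
apply: (constrain_cone (Hp i) (Ap i rp) Hl lq).
by exists 1; rewrite ?mul1r//; split => // y; rewrite mul1r.
Qed.
End lower_hemicontinuity.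

Section sADP.
Variables (R : realType) (X : khaus).
Local Open Scope ereal_scope.
Local Notation TX := (linprev_khaus R X).
Implicit Types (g : cpos R X) (h : lsc R X) (F : fork R X) (G : linprev R X).

(** For M bounding g, F^+(g) < r means F^-(M - g) > M - r, which is subbasic. *)
Lemma fork_up_open_lt g (r : R) :
  open [set F : fork R X | fork_up F (cpos_lsc g) < r%:E].
Proof.
have [M M0 gM] := cpos_bounded g.
rewrite (_ : [set _ | _] =
  [set F | (M - r)%:E < fork_lo F (cpos_lsc (cpos_compl g M))]).
  exact: fork_lo_open.
apply/seteqP; split=> F /=; have := fork_compl' F M0 gM;
  rewrite -(fineK (fork_up_fin F g)) -(fineK (fork_lo_fin F (cpos_compl g M)));
  by rewrite !lte_fin -EFinD => -[?]; lra.
Qed.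

Lemma sADP_closed F : closed (sADP_set F : set TX).
Proof.
rewrite (_ : sADP_set F = \bigcap_(g in [set: cpos R X])
    ~` [set G : linprev R X | fork_up F (cpos_lsc g) < G (cpos_lsc g)]).
  apply: closed_bigI => g _; apply: open_closedC.
  by rewrite -(fineK (fork_up_fin F g)); exact: linprev_open.
apply/seteqP; split=> G.
  by move=> /sADP_setP FG g _ /=; apply/negP; rewrite -leNgt.
by move=> H; apply/sADP_setP => g; rewrite leNgt; apply/negP; exact: H.
Qed.

Lemma sADP_attained F g :
  exists2 G, sADP_set F G & G (cpos_lsc g) = fork_up F (cpos_lsc g).
Proof.
have Fg := fork_up_fin F g; pose r := fine (fork_up F (cpos_lsc g)).
have [|G FG GA] := exists_sADP_cone (cpos_cone_ray g r) (F := F).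
  move=> a _ [t t0 [aE ->]]; rewrite EFinM /r fineK//.
  rewrite -(prevision_scale (fork_upP F).1 t0) le_eqVlt; apply/orP; left.
  by apply/eqP; congr fork_up; apply: lsc_eq => x /=; rewrite aE EFinM.
exists G => //; apply/eqP; rewrite eq_le (sADP_setP F G).1//= -(fineK Fg).
by apply: GA; exists 1%R; rewrite ?mul1r//; split => // x; rewrite mul1r.
Qed.

Fact sADP_is_lens F : is_lens (sADP_set F : set TX).
Proof.
apply/is_lensE; split.
  by have [G FG _] := sADP_attained F (cpos0 R X); exists G.
exact: (subclosed_compact (@sADP_closed F) (@khaus_compact TX)).
Qed.

Definition sADP_lens F : lens TX := Lens (@sADP_is_lens F).

(** The sets U with this property form a filter, so subbasic U suffice; for these,
    [prevision_approx] passes to a continuous function. The form matches [linear_state_liminf]: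
    strict at G, weak at G'. *)
Lemma linprev_nbhs_cpos (G : linprev R X) (U : set (linprev R X)) : nbhs G U ->
  exists2 s : seq (cpos R X * R),
    all (fun c => c.2 < fine (G (cpos_lsc c.1)))%R s &
    forall G' : linprev R X,
      all (fun c => c.2 <= fine (G' (cpos_lsc c.1)))%R s -> U G'.
Proof.
pose W : set_system (linprev R X) := [set U | exists2 s : seq (cpos R X * R),
    all (fun c => c.2 < fine (G (cpos_lsc c.1)))%R s &
    forall G' : linprev R X,
      all (fun c => c.2 <= fine (G' (cpos_lsc c.1)))%R s -> U G'].
have FW : Filter W.
  split.
  - by exists [::].
  - move=> A B [s sG sA] [t tG tB]; exists (s ++ t); rewrite ?all_cat ?sG//.
    by move=> G'; rewrite all_cat => /andP[/sA ? /tB].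
  - by move=> A B AB [s sG sA]; exists s => // G' /sA /AB.
have /(_ U) : W --> G.
  apply: (@subbase_cvg _ (@linprev_subbase R X)) => _ [h [r ->]] /= rG.
  have [g gh rg] := prevision_approx (linprevP G).1 rG.
  pose v := fine (G (cpos_lsc g)); have rv : (r < v)%R.
    by rewrite -lte_fin /v fineK// linprev_fin.
  exists [:: (g, (r + v) / 2)%R] => /=; first by rewrite andbT -/v; lra.
  move=> G'; rewrite andbT => rG'.
  apply: lt_le_trans (prevision_mono (linprevP G').1 gh).
  rewrite -(fineK (linprev_fin G' g)) lte_fin.
  by apply: lt_le_trans rG'; lra.
by move=> + GU; apply.
Qed.

Lemma sADP_lens_continuous : continuous (sADP_lens : fork R X -> lens TX).
Proof.
apply: lens_continuous => U oU; rewrite openE => F.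
- move=> /= sFU.
  have cU : compact (~` U).
    by apply: (subclosed_compact _ (@khaus_compact TX)) => //; exact: open_closedC.
  (* Each G outside U violates the bound at some g, and a real strictly between F^+(g) and G(g)
     keeps it violated near F and G. *)
  have : exists2 N, nbhs F N & forall F' G, N F' -> (~` U) G -> ~ sADP_set F' G.
    apply: (@compact_ideal TX (~` U) [set S : set (linprev R X) |
      exists2 N, nbhs F N & forall F' G, N F' -> S G -> ~ sADP_set F' G] cU) => /=.
    + by exists setT; [exact: filterT|].
    + by move=> A B AB [N FN NB]; exists N => // F' G NF' /AB; exact: NB.
    + move=> A B [N FN NA] [M FM MB]; exists (N `&` M); first exact: filterI.
      by move=> F' G [NF' MF'] [/(NA F')|/(MB F')]; apply.
    + move=> G nUG; have nFG : ~ sADP_set F G by move=> /sFU.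
      have [g Fg] : exists g, fork_up F (cpos_lsc g) < G (cpos_lsc g).
        apply: contrapT => H; apply: nFG; apply/sADP_setP => g.
        by rewrite leNgt; apply/negP => Fg; apply: H; exists g.
      have [|a Fa aG] := lte_between _ Fg; first exact: prevision_ge0 (fork_upP F).1 _.
      exists [set G' : linprev R X | a%:E < G' (cpos_lsc g)].
        by apply: open_nbhs_nbhs; split => //; exact: linprev_open.
      exists [set F' : fork R X | fork_up F' (cpos_lsc g) < a%:E].
        by apply: open_nbhs_nbhs; split => //; exact: fork_up_open_lt.
      move=> F' G' F'a aG' /sADP_setP /(_ g); apply/negP; rewrite -ltNge.
      exact: lt_trans F'a aG'.
  move=> [N FN NU]; apply: filterS FN => F' NF' G F'G; apply: contrapT => nUG.
  exact: NU NF' nUG F'G.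
- move=> /= [G [FG UG]].
  have [s sG sU] := linprev_nbhs_cpos (open_nbhs_nbhs (conj oU UG)).
  (* As G <= F^+, strict lower bounds on G(g) persist for F'^+(g) when F' is near F. *)
  have liminf g (b : R) : (b < fine (G (cpos_lsc g)))%R ->
      nbhs F [set F' : fork R X | (b < fine (fork_up F' (cpos_lsc g)))%R].
    move=> bG.
    have : nbhs F [set F' : fork R X | b%:E < fork_up F' (cpos_lsc g)].
      apply: open_nbhs_nbhs; split => /=; first exact: fork_up_open.
      apply: lt_le_trans ((sADP_setP F G).1 FG g).
      by rewrite -(fineK (linprev_fin G g)) lte_fin.
    by apply: filterS => F' /=; rewrite -{1}(fineK (fork_up_fin F' g)) lte_fin.
  have := linear_state_liminf (nbhs_filter F) (linprev_linear_state G) sG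
    (@fork_up_sublinear R X) liminf.
  apply: filterS => F' [l [Hl lF sl]].
  have [G' G'E] := linear_state_linprev Hl; exists G'; split.
    apply/sADP_setP => g.
    by rewrite G'E -(fineK (fork_up_fin F' g)) lee_fin.
  by apply: sU; apply: sub_all sl => c; rewrite G'E.
Qed.

Lemma rADP_sADP F : rADP_fork (sADP_lens F) = F.
Proof.
apply: fork_eq_up => g; apply/eqP; rewrite eq_le; apply/andP; split.
  by apply: ge_ereal_sup => _ [G FG <-]; exact: (sADP_setP F G).1.
by have [G FG <-] := sADP_attained F g; exact: (@lens_up_ge _ _ (sADP_lens F)).
Qed.
End sADP.

(** For continuous g, bounds on F^+(g) from either side are open in F. This makes y |-> u(y)^+(g) a
    continuous function, to which states apply. *)
Lemma fork_up_fine_continuous (R : realType) (X : khaus) (g : cpos R X) :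
  continuous (fun F : fork R X => fine (fork_up F (cpos_lsc g))).
Proof.
move=> F B /nbhs_ballP[e /= e0 eB].
pose v := fine (fork_up F (cpos_lsc g)).
have Fv : fork_up F (cpos_lsc g) = v%:E by rewrite fineK// fork_up_fin.
have Flo : nbhs F [set F' : fork R X | (v - e)%:E < fork_up F' (cpos_lsc g)]%E.
  apply: open_nbhs_nbhs; split; first exact: fork_up_open.
  by rewrite /= Fv lte_fin; lra.
have Fup : nbhs F [set F' : fork R X | fork_up F' (cpos_lsc g) < (v + e)%:E]%E.
  apply: open_nbhs_nbhs; split; first exact: fork_up_open_lt.
  by rewrite /= Fv lte_fin; lra.
have := @filterI _ _ (nbhs_filter F) _ _ Flo Fup.
apply: (@filterS _ _ (nbhs_filter F)) => F' [/=].
rewrite -{1 2}(fineK (fork_up_fin F' g)) !lte_fin -/v => lo up.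
by apply: eB; rewrite /ball/= ltr_norml -/v; lra.
Qed.

(** * Lifting linear previsions along a continuous family of forks *)

Section lifting.
Variables (R : realType) (X Y : khaus) (u : continuousType Y (fork R X)).
Local Open Scope ereal_scope.
Implicit Types g : cpos R X.

Fact fork_up_along_cont g :
  continuous (fun y => fine (fork_up (u y) (cpos_lsc g))).
Proof.
move=> y; apply: (@continuous_comp _ _ _ u
  (fun F : fork R X => fine (fork_up F (cpos_lsc g)))).
  exact: cts_fun.
exact: fork_up_fine_continuous.
Qed.

Fact fork_up_along_ge0 g y : (0 <= fine (fork_up (u y) (cpos_lsc g)))%R.
Proof. by rewrite fine_ge0//; exact: prevision_ge0 (fork_upP _).1 _. Qed.

Definition fork_up_along g : cpos R Y :=
  CPos (@fork_up_along_cont g) (fork_up_along_ge0 g).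

Lemma fork_up_alongE g : cpos_lsc (fork_up_along g) =
  lsc_comp u (fork_up_eval (cpos_lsc g)).
Proof. by apply: lsc_eq => y /=; rewrite fineK// fork_up_fin. Qed.

(* Hahn-Banach over the cone of all functions y |-> u(y)^+(g), on which G gives
   the lower bounds. *)
Lemma sADP_lift (FF : fork R Y) (G : linprev R X) :
  (forall g, G (cpos_lsc g) <=
    fork_up FF (lsc_comp u (fork_up_eval (cpos_lsc g)))) ->
  exists2 GG, sADP_set FF GG & forall g, G (cpos_lsc g) <=
    GG (lsc_comp u (fork_up_eval (cpos_lsc g))).
Proof.
(* Since g |-> u(y)^+(g) is only sublinear, closure under sums requires allowing larger a; smaller c
   are allowed too. *)
move=> GFF; pose A (a : cpos R Y) (c : R) := exists2 g,
  (forall y, fork_up_along g y <= a y)%R & (c <= fine (G (cpos_lsc g)))%R.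
have SF y := (fork_up_sublinear (u y)).
have SG := linprev_linear_state G.
have HA : cpos_cone A.
  split.
  - exists (cpos0 R X) => [y|]; last by rewrite (state0 SG.1).
    by rewrite /= (state0 (SF y).1).
  - move=> a1 a2 c1 c2 [g1 g1a c1g] [g2 g2a c2g]; exists (cpos_add g1 g2).
      by move=> y; apply: le_trans ((SF y).2 _ _) _; exact: lerD (g1a y) (g2a y).
    by rewrite SG.2 lerD.
  - move=> t t0 a c [g ga cg]; exists (cpos_scale t0 g) => [y|].
      by rewrite /= (state_scale (SF y).1 t0) ler_wpM2l//; exact: ga.
    by rewrite (state_scale SG.1 t0) ler_wpM2l.
have [|GG FFGG GGA] := exists_sADP_cone HA (F := FF).
  move=> a c [g ga cg].
  apply: (@le_trans _ _ (G (cpos_lsc g))).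
    by rewrite -(fineK (linprev_fin G g)) lee_fin.
  apply: le_trans (GFF g) _; rewrite -fork_up_alongE.
  by apply: prevision_mono (fork_upP FF).1 _ => y; rewrite lee_fin.
exists GG => // g; rewrite -fork_up_alongE -(fineK (linprev_fin G g)).
by apply: GGA; exists g.
Qed.
End lifting.

(** * Naturality and the distributing equations *)

Section distributing_retraction.
Variable R : realType.
Local Open Scope ereal_scope.

Definition rADP : nat_trans (functor_comp Plv (PP1 R)) (PADP1 R).
Proof.
refine (@NatTrans KHaus KHaus (functor_comp Plv (PP1 R)) (PADP1 R)
  (fun X => cmap (@rADP_fork_continuous R X)) _).
move=> X Y f; apply/continuousEP => L; apply: fork_eq_up => g /=.
by rewrite /lens_up /= image_comp.
Defined.

(** For the inclusion from left to right, the lift G' has an image above G, hence equal to G by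
    [linprev_eq_le]. *)
Lemma sADP_natural (X Y : khaus) (f : continuousType X Y) (F : fork R X) :
  sADP_set (fork_map f F) = linprev_map f @` sADP_set F.
Proof.
apply/seteqP; split=> [G /sADP_setP FG|_ [G FG <-]]; last first.
  by move=> h; exact: FG.
pose u : continuousType X (fork R Y) := ccomp (cmap (@fork_unit_continuous R Y)) f.
have uE h : lsc_comp u (fork_up_eval h) = lsc_comp f h by exact: lsc_eq.
have [|G' FG' GG'] := @sADP_lift R Y X u F G.
  by move=> g; rewrite uE; exact: FG.
exists G' => //; apply/esym/linprev_eq_le => g.
by have := GG' g; rewrite uE.
Qed.

Definition sADP : nat_trans (PADP1 R) (functor_comp Plv (PP1 R)).
Proof.
refine (@NatTrans KHaus KHaus (PADP1 R) (functor_comp Plv (PP1 R))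
  (fun X => cmap (@sADP_lens_continuous R X)) _).
move=> X Y f; apply/continuousEP => F; apply: lens_eq.
exact: sADP_natural.
Defined.

Lemma rADP_is_rADP (X : khaus) : is_rADP (rADP X).
Proof.
move=> L h; split=> //; split.
  by have [G LG e] := lens_lo_attained L h; exists G.
by move=> _ [G LG <-]; exact: lens_lo_le.
Qed.

(** Both upper parts are iterated suprema of G(g) over G in L and L in LL; on the right, L enters
    through the Dirac prevision at r(L). *)
Lemma rADP_muS (X : khaus) : rADP X \oc mu Plv (PP1 R X) =
  mu (PADP1 R) X \oc (dr_i rADP (PADP1 R X) \oc Defs.fmap Plv (rADP X)).
Proof.
apply/continuousEP => LL; apply: fork_eq_up => g /=.
apply/eqP; rewrite eq_le; apply/andP; split.
  apply: ge_ereal_sup => _ [G [L LLL LG] <-].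
  apply: (@le_trans _ _ (lens_up L (cpos_lsc g))); first exact: lens_up_ge.
  apply: ereal_sup_ubound; exists (linprev_unit R (rADP_fork L)) => //.
  by exists (rADP_fork L) => //; exists L.
apply: ge_ereal_sup => _ [_ [_ [L LLL <-] <-] <-] /=.
apply: ge_ereal_sup => _ [G LG <-]; apply: ereal_sup_ubound; exists G => //.
by exists L.
Qed.

(** This computes [dr_j], for the unit equation and for e on singletons. *)
Lemma rADP_lens_unit (X : khaus) (G : linprev R X) :
  rADP_fork (@lens_unit (linprev_khaus R X) G) = linprev_fork G.
Proof.
by apply: fork_eq_up => g; rewrite /= /lens_up /= image_set1 ereal_sup1.
Qed.

Lemma rADP_muT (X : khaus) : rADP X \oc Defs.fmap Plv (mu (PP1 R) X) =
  mu (PADP1 R) X \oc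
    (rADP (PADP1 R X) \oc Defs.fmap Plv (Defs.fmap (PP1 R) (dr_j rADP X))).
Proof.
apply/continuousEP => L; apply: fork_eq_up => g /=.
rewrite /lens_up /= !image_comp; congr ereal_sup.
apply: eq_imagel => GG LGG /=; congr (linprev_fun GG _).
by apply: lsc_eq => G /=; rewrite /lens_up /= image_set1 ereal_sup1.
Qed.

Lemma sADP_linprev_fork (X : khaus) (G : linprev R X) :
  sADP_set (linprev_fork G) = [set G].
Proof.
apply/seteqP; split=> [G' /sADP_setP GG'|_ ->]; first exact: linprev_eq_le.
by apply/sADP_setP => g.
Qed.

(** The equation between e and mu^T. Lifting along [linprev_fork] gives the inclusion from left to
    right, since u(G)^+(h) is then G(h). *)
Lemma sADP_rADP_muT (X : khaus) (L : lens (linprev_khaus R (linprev_khaus R X))) :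
  sADP_set (rADP_fork (lens_map (mu (PP1 R) X) L)) =
  linprev_mult (X := X) @` sADP_set (rADP_fork L).
Proof.
have upE h : lens_up (lens_map (mu (PP1 R) X) L) h = lens_up L (linprev_eval h).
  by rewrite /lens_up /= image_comp.
apply/seteqP; split=> [G /sADP_setP /= LG|_ [GG LGG <-]]; last first.
  apply/sADP_setP => g /=; rewrite upE.
  by have [] := LGG (linprev_eval (cpos_lsc g)).
have cu : continuous (@linprev_fork R X).
  by apply: fork_continuous => h r; exact: linprev_open.
have uE h : lsc_comp (cmap cu) (fork_up_eval h) = linprev_eval h by exact: lsc_eq.
have [|GG LGG GGG] := @sADP_lift R X (linprev_khaus R X) (cmap cu) (rADP_fork L) G.
  by move=> g; rewrite uE /= -upE; exact: LG.
exists GG => //; apply/esym/linprev_eq_le => g.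
by have := GGG g; rewrite uE.
Qed.

(** The map whose Kleisli extension has to commute with e. *)
Definition ext (X : khaus) : Defs.hom (PP1 R (PADP1 R X)) (Plv (PP1 R X)) :=
  sADP X \oc (mu (PADP1 R) X \oc dr_j rADP (PADP1 R X)).

Lemma ext_fork_upE (X : khaus) (FF : linprev R (fork_khaus R X)) (h : lsc R X) :
  fork_up (fork_mult
    (rADP_fork (@lens_unit (linprev_khaus R (fork_khaus R X)) FF))) h =
  FF (fork_up_eval h).
Proof. by rewrite /= /lens_up /= image_set1 ereal_sup1. Qed.

Lemma extP (X : khaus) (FF : linprev R (fork_khaus R X)) (G : linprev R X) :
  lens_set (ext X FF) G <->
  forall g, G (cpos_lsc g) <= FF (fork_up_eval (cpos_lsc g)).
Proof.
split=> [/sADP_setP H g|H]; first by rewrite -ext_fork_upE; exact: H.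
by apply/sADP_setP => g; rewrite ext_fork_upE.
Qed.

(** The last equation, in terms of sets. Lifting along the identity provides FF for a given G. *)
Lemma sADP_rADP_ext (X : khaus) (L : lens (linprev_khaus R (fork_khaus R X))) :
  sADP_set (rADP_fork (lens_mult (lens_map (ext X) L))) =
  \bigcup_(FF in sADP_set (rADP_fork L)) lens_set (ext X FF).
Proof.
have upE g : lens_up (lens_mult (lens_map (ext X) L)) (cpos_lsc g) =
    lens_up L (fork_up_eval (cpos_lsc g)).
  apply/eqP; rewrite eq_le; apply/andP; split.
    apply: ge_ereal_sup => _ [G [_ [FF LFF <-] /extP FFG] <-].
    by apply: le_trans (FFG g) _; exact: lens_up_ge.
  apply: ge_ereal_sup => _ [FF LFF <-].
  (* The bound that defines [ext X FF] is attained at g, so passing to its members does not lower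
     the supremum. *)
  have [G FFG] := sADP_attained (fork_mult
    (rADP_fork (@lens_unit (linprev_khaus R (fork_khaus R X)) FF))) g.
  rewrite ext_fork_upE => <-; apply: ereal_sup_ubound; exists G => //.
  by exists (ext X FF) => //; exists FF.
apply/seteqP; split=> [G /sADP_setP LG|G [FF LFF /extP FFG]]; last first.
  apply/sADP_setP => g; rewrite /= upE; apply: le_trans (FFG g) _.
  by have [] := LFF (fork_up_eval (cpos_lsc g)).
pose u := Defs.cid (fork_khaus R X).
have uE (h : lsc R X) : lsc_comp u (fork_up_eval h) = fork_up_eval h.
  exact: lsc_eq.
have [|FF LFF GFF] := @sADP_lift R X (fork_khaus R X) u (rADP_fork L) G.
  by move=> g; rewrite uE /= -upE; exact: LG.
by exists FF => //; apply/extP => g; have := GFF g; rewrite uE.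
Qed.

Lemma rADP_sADP_distributing : distributing_retraction rADP sADP.
Proof.
split.
- by move=> X; apply/continuousEP => F; exact: rADP_sADP.
- by move=> X; apply/continuousEP => x; apply: etrans (rADP_lens_unit _) (fork_eq _ _).
- exact: rADP_muS.
- exact: rADP_muT.
- move=> X; apply/continuousEP => G; apply: lens_eq.
  exact: etrans (congr1 (@sADP_set R X) (rADP_lens_unit G)) (sADP_linprev_fork G).
- by move=> X; apply/continuousEP => L; apply: lens_eq; exact: sADP_rADP_muT.
- move=> X; apply/continuousEP => L; apply: lens_eq.
  apply: etrans (sADP_rADP_ext L) _; by rewrite /= bigcup_image.
Qed.
End distributing_retraction.

Theorem mainTheorem7 (R : realType) :
  exists (r : nat_trans (functor_comp Plv (PP1 R)) (PADP1 R))
         (s : nat_trans (PADP1 R) (functor_comp Plv (PP1 R))),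
    [/\ forall X : khaus, is_rADP (r X),
        forall X : khaus, is_sADP (s X)
      & distributing_retraction r s].
Proof.
exists (rADP R), (sADP R); split=> //; first exact: rADP_is_rADP.
exact: rADP_sADP_distributing.
Qed.
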